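(* Let $n\ge1$ and let $q,r,\widetilde q,\widetilde r\in[1,\infty]$. Suppose that there is a constant $C$ such that $$\bigg\|\int_0^t e^{i(t-s)\Delta}F(s)\,ds\bigg\|_{L^r_xL^q_t}\le C\,\|F\|_{L^{\widetilde r'}_xL^{\widetilde q'}_t}\qquad\text{for all }F.$$ Then $$\frac1{\widetilde q'}-\frac1q+(n+1)\Big(\frac1{\widetilde r'}-\frac1r\Big)\ge 2,$$ and $$\frac1{\widetilde q'}-\frac1q\ge\frac{2n}{r}-n+1,\qquad \frac1{\widetilde q'}-\frac1q\ge n+1-\frac{2n}{\widetilde r'}.$$
   Context: Here $(x,t)\in\mathbb R^n\times\mathbb R$, and $F(s)=F(\cdot,s)$. The free Schrödinger propagator is $e^{it\Delta}f(x)=(2\pi)^{-n}\int_{\mathbb R^n}e^{i(x\cdot\xi-t|\xi|^2)}\widehat f(\xi)\,d\xi$. The mixed norm takes time integration first: $\|G\|_{L^r_xL^q_t}=\big\|\,\|G(x,\cdot)\|_{L^q(\mathbb R)}\big\|_{L^r_x(\mathbb R^n)}$. A prime on an exponent denotes the Hölder conjugate, so $1/\widetilde r+1/\widetilde r'=1$ and $1/\widetilde q+1/\widetilde q'=1$. The inequality is an a priori estimate: it is understood for all Schwartz functions $F$ on $\mathbb R^n\times\mathbb R$, with $C$ independent of $F$. *)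

(* Defs.v *)
From HB Require Import structures.
From mathcomp Require Import all_boot all_order all_algebra.
From mathcomp Require Import all_classical all_reals all_analysis.
From mathcomp Require Import complex.

Set Implicit Arguments.
Unset Strict Implicit.
Unset Printing Implicit Defensive.

Import Order.TTheory GRing.Theory Num.Theory.
Import numFieldNormedType.Exports.

Local Open Scope classical_set_scope.
Local Open Scope ring_scope.

(* 'rV[T]_n carries the product sigma-algebra, generated by the coordinates. *)
Definition measure_rV_display : measure_display -> measure_display.
Proof. exact. Qed.

Section measurable_rV.
Context {d} {T : measurableType d} (n : nat).

Let coors : 'I_n -> 'rV[T]_n -> T := fun i x => x ord0 i.

Let rV_set0 : g_sigma_preimage coors set0.
Proof. exact: sigma_algebra0. Qed.

Let rV_setC A : g_sigma_preimage coors A -> g_sigma_preimage coors (~` A).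
Proof. exact: sigma_algebraC. Qed.

Let rV_bigcup (F : _^nat) : (forall i, g_sigma_preimage coors (F i)) ->
  g_sigma_preimage coors (\bigcup_i (F i)).
Proof. exact: sigma_algebra_bigcup. Qed.

HB.instance Definition _ := @isMeasurable.Build (measure_rV_display d)
  'rV[T]_n (g_sigma_preimage coors) rV_set0 rV_setC rV_bigcup.

End measurable_rV.

Lemma measurable_coord_rV d (T : measurableType d) n (i : 'I_n) :
  measurable_fun [set: 'rV[T]_n] (fun x : 'rV[T]_n => x ord0 i).
Proof.
move=> _ Y mY; rewrite setTI; apply: sub_sigma_algebra => /=.
rewrite -bigcup_seq/=; exists i => /=; first by rewrite mem_index_enum.
by exists Y => //; rewrite setTI.
Qed.

Lemma measurable_fun_rVP d1 d2 (T1 : measurableType d1)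
    (T2 : measurableType d2) n (f : T1 -> 'rV[T2]_n) :
  measurable_fun [set: T1] f <->
  forall i, measurable_fun [set: T1] (fun x => f x ord0 i).
Proof.
split=> [mf i|mf].
  exact: (measurableT_comp (@measurable_coord_rV _ T2 n i) mf).
apply: (measurability (\big[setU/set0]_(i < n)
  preimage_set_system setT (fun x : 'rV[T2]_n => x ord0 i) measurable)) => //.
move=> _ [B + <-]; rewrite -bigcup_seq/= => -[i _ [C mC <-]].
rewrite !setTI; have := mf i measurableT C mC.
by rewrite setTI.
Qed.

Definition rVcons (T : Type) n (p : T * 'rV[T]_n) : 'rV[T]_n.+1 :=
  \row_i oapp (p.2 ord0) p.1 (unlift ord0 i).

Definition rVuncons (T : Type) n (x : 'rV[T]_n.+1) : T * 'rV[T]_n :=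
  (x ord0 ord0, \row_i x ord0 (lift ord0 i)).

Lemma rVcons0 (T : Type) n (p : T * 'rV[T]_n) : rVcons p ord0 ord0 = p.1.
Proof. by rewrite mxE unlift_none. Qed.

Lemma rVconsS (T : Type) n (p : T * 'rV[T]_n) i :
  rVcons p ord0 (lift ord0 i) = p.2 ord0 i.
Proof. by rewrite mxE liftK. Qed.

Lemma rVconsK (T : Type) n : cancel (@rVcons T n) (@rVuncons T n).
Proof.
move=> p; rewrite /rVuncons rVcons0 [RHS]surjective_pairing; congr pair.
by apply/rowP => i; rewrite mxE rVconsS.
Qed.

Lemma measurable_rVcons d (T : measurableType d) n :
  measurable_fun [set: T * 'rV[T]_n] (@rVcons T n).
Proof.
apply/measurable_fun_rVP => i; have [j ->|->] := unliftP ord0 i.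
  rewrite (_ : (fun _ => _) = (fun x : 'rV[T]_n => x ord0 j) \o snd).
    exact: (measurableT_comp (@measurable_coord_rV _ T n j) measurable_snd).
  by apply/funext => p; rewrite rVconsS.
rewrite (_ : (fun _ => _) = fst); first exact: measurable_fst.
by apply/funext => p; rewrite rVcons0.
Qed.

Lemma measurable_rVuncons d (T : measurableType d) n :
  measurable_fun [set: 'rV[T]_n.+1] (@rVuncons T n).
Proof.
apply/measurable_fun_pairP; split; first exact: measurable_coord_rV.
apply/measurable_fun_rVP => i /=.
rewrite (_ : (fun _ => _) = fun x : 'rV[T]_n.+1 => x ord0 (lift ord0 i)).
  exact: measurable_coord_rV.
by apply/funext => x; rewrite /rVuncons/= mxE.
Qed.

Section lebesgue_rVS.
Context {R : realType} (n : nat).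
Variable m : {sigma_finite_measure set 'rV[R]_n -> \bar R}.

Definition lebesgue_rVS : set 'rV[R]_n.+1 -> \bar R :=
  pushforward (@lebesgue_measure R \x m)%E (@rVcons R n).

Let m0 : lebesgue_rVS set0 = 0%E.
Proof. by rewrite /lebesgue_rVS /pushforward preimage_set0 measure0. Qed.

Let mpre (A : set 'rV[R]_n.+1) : measurable A ->
  @measurable _ (measurableTypeR R * 'rV[R]_n)%type (@rVcons R n @^-1` A).
Proof. by move=> mA; rewrite -[X in measurable X]setTI; exact: measurable_rVcons. Qed.

Let m_ge0 A : (0 <= lebesgue_rVS A)%E.
Proof. by rewrite /lebesgue_rVS /pushforward measure_ge0. Qed.

Let m_sigma_additive : semi_sigma_additive lebesgue_rVS.
Proof.
move=> F mF tF mUF; rewrite /lebesgue_rVS /pushforward preimage_bigcup.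
apply: measure_semi_sigma_additive.
- by move=> k; exact: mpre.
- apply/trivIsetP => /= i j _ _ ij; rewrite -preimage_setI.
  by move/trivIsetP : tF => /(_ _ _ _ _ ij) ->//; rewrite preimage_set0.
- by rewrite -preimage_bigcup; exact: mpre.
Qed.

HB.instance Definition _ := isMeasure.Build _ _ _ lebesgue_rVS
  m0 m_ge0 m_sigma_additive.

Let m_sigma_finite : sigma_finite setT lebesgue_rVS.
Proof.
have /sigma_finiteP[F [TF ndF Foo]] := sigma_finiteT (@lebesgue_measure R).
have /sigma_finiteP[G [TG ndG Goo]] := sigma_finiteT m.
exists (fun k => @rVuncons R n @^-1` (F k `*` G k)).
  rewrite -preimage_bigcup (_ : \bigcup_k _ = setT) ?preimage_setT//.
  rewrite -subTset => -[x y] _.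
  have [i _ Fx] : (\bigcup_i F i) x by rewrite -TF.
  have [j _ Gy] : (\bigcup_i G i) y by rewrite -TG.
  exists (maxn i j) => //; split => /=.
    by move: x Fx; exact/subsetPset/ndF/leq_maxl.
  by move: y Gy; exact/subsetPset/ndG/leq_maxr.
move=> k; have [mF Fk] := Foo k; have [mG Gk] := Goo k; split.
  rewrite -[X in measurable X]setTI.
  by apply: (@measurable_rVuncons _ R n) => //; exact: measurableX.
rewrite /lebesgue_rVS /pushforward -comp_preimage.
rewrite (_ : _ \o _ = id); last by apply/funext => p /=; rewrite rVconsK.
by rewrite preimage_id product_measure1E// lte_mul_pinfty// ge0_fin_numE.
Qed.

HB.instance Definition _ := Measure_isSigmaFinite.Build _ _ _ lebesgue_rVS
  m_sigma_finite.

End lebesgue_rVS.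

(* Lebesgue measure on R^n: the n-fold product of Lebesgue measure on R. *)
Fixpoint lebesgue_rV (R : realType) (n : nat) :
    {sigma_finite_measure set 'rV[R]_n -> \bar R} :=
  match n return {sigma_finite_measure set 'rV[R]_n -> \bar R} with
  | 0 => @dirac _ 'rV[R]_0 (0 : 'rV[R]_0) R
  | n'.+1 => lebesgue_rVS (lebesgue_rV R n')
  end.

Lemma lebesgue_rV_box (R : realType) n (A : 'I_n -> set R) :
  (forall i, measurable (A i)) ->
  lebesgue_rV R n [set x : 'rV[R]_n | forall i, A i (x ord0 i)] =
  (\prod_(i < n) lebesgue_measure (A i))%E.
Proof.
elim: n A => [A _|n IHn A mA].
  by rewrite big_ord0 /= diracE mem_set//= => -[].
rewrite big_ord_recl -IHn//= /lebesgue_rVS /pushforward.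
have mB : measurable [set x : 'rV[R]_n | forall i, A (lift ord0 i) (x ord0 i)].
  rewrite (_ : mkset _ = \bigcap_(i in [set: 'I_n])
      (fun x : 'rV[R]_n => x ord0 i) @^-1` A (lift ord0 i)).
    apply: fin_bigcap_measurable => // i _.
    by rewrite -[X in measurable X]setTI; exact: measurable_coord_rV.
  by apply/seteqP; split => x /= Ax => [i _|i]; exact: Ax.
rewrite -product_measure1E//; last exact: mA.
congr (product_measure1 _ _ _).
apply/seteqP; split => [[x y]/= Axy|[x y] [/= Ax Ay] i].
  split; first by have := Axy ord0; rewrite rVcons0.
  by move=> i; have := Axy (lift ord0 i); rewrite rVconsS.
by have [j ->|->] := unliftP ord0 i; rewrite ?rVcons0 ?rVconsS//; exact: Ay.
Qed.

Section schwartz.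
Context {R : realType} {V : normedModType R}.

(* iter_derive [:: v1; ...; vk] f = D_v1 (... (D_vk f)). *)
Definition iter_derive (vs : seq V) (f : V -> R) : V -> R :=
  foldr (fun v g => 'D_v g) f vs.

Definition smooth (f : V -> R) : Prop :=
  forall vs : seq V, continuous (iter_derive vs f) /\
    forall v x, derivable (iter_derive vs f) x v.

(* For V of finite dimension (the only use below), testing all directional
   derivatives against all powers of the norm amounts to testing all partial
   derivatives against all monomials. *)
Definition schwartz_real (f : V -> R) : Prop :=
  smooth f /\
  forall (k : nat) (vs : seq V), exists M : R,
    forall x, `|x| ^+ k * `|iter_derive vs f x| <= M.

Definition schwartz (f : V -> R[i]) : Prop :=
  schwartz_real (fun x => complex.Re (f x)) /\
  schwartz_real (fun x => complex.Im (f x)).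

End schwartz.

Section propagator.
Context {R : realType}.

Definition Cintegral d (T : measurableType d)
    (mu : {measure set T -> \bar R}) (D : set T) (f : T -> R[i]) : R[i] :=
  ((\int[mu]_(x in D) complex.Re (f x)) +i* (\int[mu]_(x in D) complex.Im (f x)))%C.

Definition Cintegral_ab (a b : R) (f : R -> R[i]) : R[i] :=
  if a <= b then Cintegral (@lebesgue_measure R) `[a, b] f
  else - Cintegral (@lebesgue_measure R) `[b, a] f.

Definition cexpi (theta : R) : R[i] := (cos theta +i* sin theta)%C.

Definition dot_rV n (x y : 'rV[R]_n) : R := \sum_i x ord0 i * y ord0 i.

Definition fourier n (f : 'rV[R]_n -> R[i]) (xi : 'rV[R]_n) : R[i] :=
  Cintegral (lebesgue_rV R n) setT (fun x => cexpi (- dot_rV x xi) * f x).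

(* e^(i t Delta) f for f Schwartz; the factor (2 pi)^-n of the inversion formula
   is here, the Fourier transform being unnormalized. *)
Definition schrodinger n (t : R) (f : 'rV[R]_n -> R[i]) (x : 'rV[R]_n) : R[i] :=
  ((2 * pi) ^- n)%:C%C *
  Cintegral (lebesgue_rV R n) setT
    (fun xi => cexpi (dot_rV x xi - t * dot_rV xi xi) * fourier f xi).

Definition duhamel n (F : 'rV[R]_n * R -> R[i]) (z : 'rV[R]_n * R) : R[i] :=
  Cintegral_ab 0 z.2
    (fun s => schrodinger (z.2 - s) (fun y => F (y, s)) z.1).

(* The L^q norm in time is the inner one. *)
Definition mixed_norm n (r q : \bar R) (G : 'rV[R]_n * R -> R[i]) : \bar R :=
  Lnorm (lebesgue_rV R n) r (fun x =>
    Lnorm (@lebesgue_measure R) q (fun t => (Normc.normc (G (x, t)))%:E)).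

(* 1/p as a real number, with 1/oo = 0. *)
Definition inv_exponent (p : \bar R) : R := fine p^-1%E.

End propagator.

(* Main.v *)
Require Import Defs.
From mathcomp Require Import all_boot all_order all_algebra.
From mathcomp Require Import all_classical all_reals all_analysis.
From mathcomp Require Import ess_sup_inf measurable_realfun complex ring lra.

Set Implicit Arguments.
Unset Strict Implicit.
Unset Printing Implicit Defensive.

Import Order.TTheory GRing.Theory Num.Theory.
Import numFieldNormedType.Exports.

Local Open Scope ring_scope.
Local Open Scope classical_set_scope.

(** Everything comes from constructive interference of wave packets that travel
at speed one.  The Gaussian phi(y) = exp(-|y|^2/4) has an explicit evolution
([schrodinger_gauss_sum]), built from the one-dimensional integral
[oscillatory_gaussian_integral].  If tau is comparable with M^2 and
|tau - d| <= 2M, where d = |w|, then the value of exp(i tau Delta) phi at w has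
modulus of order M^-n and, since d^2/(4 tau) = d/2 - tau/4 + (tau-d)^2/(4 tau),
phase d/2 - tau/4 - n pi/4 up to a small error ([phase_error], [modulus_ge]).

Let a source emit phi centred at y_k during the time window of length M that
starts at S0 - b_k, with phase -s/4 - b_k/2.  At a point x with
|x - y_k| = a(x) + b_k up to 1/2, and at a time t in the window of length M that
starts at S0 + a(x), all contributions arrive with the phase
a(x)/2 - t/4 - n pi/4, up to 1, whatever k and the emission time s are.  They
therefore add up: with N centres the Duhamel integral has modulus at least
c N M M^-n ([duhamel_lower]).  If this happens for all x in a set of measure V,
the left-hand norm is at least c N M^(1-n) M^(1/q) V^(1/r).  If the centres are
separated, the Gaussians hardly overlap and the norm of the source is at most
C M^(1/q1') N^(1/r1') ([mixed_norm_source]).  For N of order M^p and V of order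
M^v, letting M tend to infinity leaves the condition
  p + 1 - n + 1/q + v/r <= 1/q1' + p/r1'      ([scaling_condition]).

The three inequalities are three geometries for which |x - y_k| splits as
a(x) + b_k.
- Beam, p = v = n+1: both the centres and the receiving set fill tubes of length
  M^2 and width M around the first axis; the distance is x_0 - y_0 + O(1)
  ([coherent_beam]).
- Point source, p = 0 and v = 2n: one centre, and the receiving set is a cube of
  side M^2 at distance M^2; the distance is |x| ([coherent_point_source]).
- Focus, p = 2n and v = 0: the centres fill such a cube, and the receiving set
  is a small fixed cube at the origin; the distance is |y_k| + O(1)
  ([coherent_focus]).

The source must also be a Schwartz function; this is why the time windows are
cut off smoothly ([schwartz_source]). *)

(** * Lebesgue norms *)
Section Lnorm_bounds.
Context d (T : measurableType d) (R : realType) (mu : {measure set T -> \bar R}).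
Implicit Types (f g : T -> \bar R) (p : \bar R).

(** The integral of a nonnegative function is a supremum over the simple functions
below it, so the integral is monotone on arbitrary nonnegative functions, in
particular on the modulus of a Duhamel integral. *)
Lemma ge0_le_integral_gen f g :
  (forall x, (0 <= f x)%E) -> (forall x, (f x <= g x)%E) ->
  (\int[mu]_x f x <= \int[mu]_x g x)%E.
Proof.
move=> f0 fg.
have g0 x : (0 <= g x)%E by exact: le_trans (f0 x) (fg x).
rewrite !ge0_integralTE//; apply: le_ereal_sup => _ [h hf <-].
by exists h => // x; exact: le_trans (hf x) (fg x).
Qed.

Lemma le_Lnorm p f g : (1 <= p)%E -> (forall x, (`|f x| <= `|g x|)%E) ->
  (Lnorm mu p f <= Lnorm mu p g)%E.
Proof.
case: p => [p| |]// p1 fg; rewrite unlock /=.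
  have p0 : 0 < p by rewrite (lt_le_trans ltr01).
  apply: gt0_ler_poweR.
  - by rewrite invr_ge0 ltW.
  - by rewrite in_itv/= leey andbT; apply: integral_ge0 => x _; exact: poweR_ge0.
  - by rewrite in_itv/= leey andbT; apply: integral_ge0 => x _; exact: poweR_ge0.
  apply: ge0_le_integral_gen => x; first exact: poweR_ge0.
  apply: gt0_ler_poweR; first exact: ltW.
  - by rewrite in_itv/= leey andbT.
  - by rewrite in_itv/= leey andbT.
  - exact: fg.
case: ifPn => // _; apply: le_ess_sup; exact: nearW.
Qed.

(** Chebyshev's inequality, uniformly in the exponent: infinite exponents are
included since their inverse exponent is 0. *)
Lemma Lnorm_lower p f (A : set T) (v m : R) : (1 <= p)%E -> measurable A ->
  mu A = v%:E -> 0 < v -> 0 <= m -> (forall x, A x -> (m%:E <= `|f x|)%E) ->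
  ((m * v `^ inv_exponent p)%:E <= Lnorm mu p f)%E.
Proof.
move=> p1 mA muA v0 m0 mf.
case: p p1 => [p| |]// p1.
  have p0 : 0 < p by rewrite (lt_le_trans ltr01).
  have pn0 : p != 0 by rewrite gt_eqF.
  rewrite /inv_exponent inver (negbTE pn0)/=.
  apply: (@le_trans _ _ (Lnorm mu p%:E (fun x => (m * \1_A x)%:E))); last first.
    apply: le_Lnorm => // x; rewrite indicE; case: (boolP (x \in A)) => [xA|_].
      by rewrite mulr1 /= ger0_norm// mf// -inE.
    by rewrite mulr0 /= normr0 abse_ge0.
  rewrite unlock /=.
  rewrite (_ : (\int[mu]_x _)%E = ((m `^ p) * v)%:E); last first.
    rewrite (eq_integral (fun x => (m `^ p)%:E * (\1_A x)%:E)%E); last first.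
      move=> x _; rewrite indicE; case: (boolP (x \in A)) => _.
        by rewrite mulr1 mule1 ger0_norm.
      by rewrite mulr0 mule0 normr0 powR0.
    rewrite ge0_integralZl_EFin ?powR_ge0//.
    - by rewrite integral_indic// setIT muA.
    - by apply/measurable_EFinP; exact: measurable_indic.
  rewrite poweR_EFin powRM ?powR_ge0 ?(ltW v0)// lee_fin.
  by rewrite -powRrM divff// powRr1.
rewrite /inv_exponent invey/= powRr0 mulr1 unlock/=.
have muT : (0 < mu [set: T])%E.
  rewrite (@lt_le_trans _ _ (mu A))//; first by rewrite muA lte_fin.
  by apply: le_measure; rewrite ?inE.
rewrite muT leNgt; apply/negP => sm.
have := @ess_sup_ge _ _ _ mu (abse \o f) => -[N [mN N0 sub]].
have AN : A `<=` N.
  move=> x Ax; apply: sub => /= fx.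
  have := le_lt_trans (le_trans (mf x Ax) fx) sm.
  by rewrite ltxx.
have := le_measure mu (mem_set mA) (mem_set mN) AN.
by rewrite [X in (_ <= X)%E]N0 [X in (X <= _)%E]muA lee_fin leNgt v0.
Qed.

(** Interpolation between the bounds B in L^oo and V B in L^1. *)
Lemma Lnorm_upper p (f : T -> R) (B V : R) : (1 <= p)%E ->
  measurable_fun setT f -> 0 <= B -> 0 <= V ->
  (forall x, 0 <= f x) -> (forall x, f x <= B) ->
  (\int[mu]_x (f x)%:E <= (V * B)%:E)%E ->
  (Lnorm mu p (EFin \o f) <= (B * V `^ inv_exponent p)%:E)%E.
Proof.
move=> p1 mf B0 V0 f0 fB If.
case: p p1 => [p| |]// p1.
  have p0 : 0 < p by rewrite (lt_le_trans ltr01).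
  have pn0 : p != 0 by rewrite gt_eqF.
  have powRB1 (x : R) : 0 <= x -> x != 0 -> x `^ p = x `^ (p - 1) * x.
    move=> x0 xn0; rewrite -[X in _ * X](powRr1 x0) -powRD ?subrK//.
    by rewrite xn0 implybT.
  rewrite /inv_exponent inver (negbTE pn0)/= unlock/=.
  apply: (@le_trans _ _ ((B `^ p * V)%:E `^ p^-1)%E); last first.
    rewrite poweR_EFin powRM ?powR_ge0// lee_fin.
    by rewrite -powRrM divff// powRr1.
  apply: gt0_ler_poweR.
  - by rewrite invr_ge0 ltW.
  - by rewrite in_itv/= leey andbT; apply: integral_ge0 => x _; rewrite lee_fin powR_ge0.
  - by rewrite in_itv/= leey andbT lee_fin mulr_ge0 ?powR_ge0.
  apply: (@le_trans _ _ (\int[mu]_x ((B `^ (p - 1))%:E * (f x)%:E)%E)%E).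
    apply: ge0_le_integral_gen => x; first by rewrite lee_fin powR_ge0.
    rewrite lee_fin ger0_norm//.
    have [->|fx0] := eqVneq (f x) 0; first by rewrite powR0// mulr0.
    rewrite powRB1//.
    apply: ler_wpM2r => //; apply: ge0_ler_powR; rewrite ?nnegrE//.
    by rewrite subr_ge0 -lee_fin.
  rewrite ge0_integralZl_EFin//; last 3 first.
  - by move=> x _; rewrite lee_fin.
  - exact/measurable_EFinP.
  - exact: powR_ge0.
  apply: (@le_trans _ _ ((B `^ (p - 1))%:E * (V * B)%:E)%E).
    by apply: lee_wpmul2l => //; rewrite lee_fin powR_ge0.
  rewrite -EFinM lee_fin.
  have [->|Bn0] := eqVneq B 0; first by rewrite !mulr0 mulr_ge0 ?powR_ge0.
  by rewrite (powRB1 B)// mulrCA mulrC.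
rewrite /inv_exponent invey/= powRr0 mulr1 unlock/=.
case: ifPn => // _.
apply: (@le_trans _ _ (ess_sup mu (cst B%:E))).
  by apply: le_ess_sup; apply: nearW => x /=; rewrite lee_fin ger0_norm.
by apply: ereal_inf_lbound => /=; exact: nearW.
Qed.

End Lnorm_bounds.

(** * Gaussian integrals on the line *)
Lemma is_derive_continuous (R : realType) (f df : R -> R) :
  (forall x : R, is_derive x 1 f (df x)) -> continuous f.
Proof.
move=> hf x; apply: differentiable_continuous; apply/derivable1_diffP.
by have [] := hf x.
Qed.

Ltac derive1 := apply: is_derive_eq; rewrite /GRing.scale/=.

Section gauss_weight.
Context (R : realType).
Notation leb := (@lebesgue_measure R).

(** Obtained from the total mass of the normal distribution of mean m and
variance 1/(2a). *)
Lemma integral_gaussian (a : R) (a0 : 0 < a) (m : R) :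
  leb.-integrable setT (fun y : R => (expR (- a * (y - m) ^+ 2))%:E) /\
  \int[leb]_y expR (- a * (y - m) ^+ 2) = Num.sqrt (pi / a).
Proof.
pose s := Num.sqrt (2 * a)^-1.
have s0 : s != 0 by rewrite gt_eqF// sqrtr_gt0 invr_gt0 mulr_gt0.
have s2 : s ^+ 2 = (2 * a)^-1 by rewrite sqr_sqrtr// invr_ge0 mulr_ge0// ltW.
have fE y : expR (- a * (y - m) ^+ 2) = (normal_peak s)^-1 * normal_pdf m s y.
  rewrite normal_pdfE// mulKf ?gt_eqF ?normal_peak_gt0// /normal_fun s2.
  congr expR; rewrite -mulr_natr; field; exact: lt0r_neq0.
have I := integrable_normal_pdf m s.
split.
  have -> : (fun y : R => (expR (- a * (y - m) ^+ 2))%:E) =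
      (fun y : R => ((normal_peak s)^-1)%:E * (normal_pdf m s y)%:E)%E.
    by apply/funext => y; rewrite fE EFinM.
  exact: integrableZl.
under eq_Rintegral do rewrite fE.
rewrite RintegralZl// /Rintegral integral_normal_pdf mulr1 /normal_peak invrK s2.
by congr Num.sqrt; rewrite -mulr_natr; field; exact: lt0r_neq0.
Qed.

Lemma gauss_tail (a : R) (a0 : 0 < a) (y : R) :
  (1 + y ^+ 2) * expR (- a * y ^+ 2) <= (1 + 2 / a) * expR (- (a / 2) * y ^+ 2).
Proof.
have -> : - a * y ^+ 2 = - (a / 2) * y ^+ 2 - a / 2 * y ^+ 2 by field.
rewrite expRD [leLHS]mulrCA [leLHS]mulrC ler_wpM2r ?expR_ge0//.
rewrite mulrDl mul1r lerD//.
  by rewrite -expR0 ler_expR oppr_le0 mulr_ge0 ?sqr_ge0// divr_ge0// ltW.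
rewrite expRN ler_pdivrMr ?expR_gt0//.
have E : y ^+ 2 = 2 / a * (a / 2 * y ^+ 2) by field; exact: lt0r_neq0.
rewrite [leLHS]E ler_pM2l ?divr_gt0//.
by apply: le_trans (expR_ge1Dx _); rewrite lerDr.
Qed.

Lemma gauss_dominated (a : R) (a0 : 0 < a) (f : R -> R) (C : R) : continuous f ->
  (forall y, `|f y| <= C * ((1 + y ^+ 2) * expR (- a * y ^+ 2))) ->
  leb.-integrable setT (fun y => (f y)%:E).
Proof.
move=> cf fb.
have C0 : 0 <= C.
  have := le_trans (normr_ge0 _) (fb 0).
  by rewrite !expr0n/= addr0 mul1r mulr0 expR0 mulr1.
have a20 : 0 < a / 2 by rewrite divr_gt0.
have ig : leb.-integrable setT
    (fun y : R => (C * (1 + 2 / a))%:E * (expR (- (a / 2) * y ^+ 2))%:E)%E.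
  apply: integrableZl => //.
  have -> : (fun y : R => (expR (- (a / 2) * y ^+ 2))%:E) =
      (fun y : R => (expR (- (a / 2) * (y - 0) ^+ 2))%:E).
    by apply/funext => y; rewrite subr0.
  by have [] := integral_gaussian a20 0.
apply: le_integrable ig => //.
  by apply/measurable_EFinP; exact: continuous_measurable_fun.
move=> y _; rewrite /= lee_fin (le_trans (fb y))// ger0_norm; last first.
  by rewrite !mulr_ge0 ?expR_ge0// addr_ge0// divr_ge0// ltW.
by rewrite -[leRHS]mulrA ler_wpM2l// gauss_tail.
Qed.

(** Integration by parts without boundary terms: apply the fundamental theorem of
calculus on [-n, n] and let n tend to infinity. *)
Lemma integral_derivative_eq0 (a : R) (a0 : 0 < a) (H h : R -> R) (C : R) :
  (forall y : R, is_derive y 1 H (h y)) -> continuous h ->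
  (forall y, `|H y| <= C * ((1 + y ^+ 2) * expR (- a * y ^+ 2))) ->
  leb.-integrable setT (fun y => (h y)%:E) ->
  \int[leb]_y h y = 0.
Proof.
move=> dH ch Hb ih.
pose I n := `[- (n%:R : R), n%:R]%classic.
pose f n (y : R) := ((h \_ (I n)) y)%:E.
have cvgf : (\int[leb]_y f n y)%E @[n --> \oo] --> (\int[leb]_y (h y)%:E)%E.
  apply: (@dominated_cvg _ _ _ leb setT _ f _ (fun y => `|(h y)%:E|%E)) => //.
  - move=> n; apply/measurable_EFinP/(measurable_restrictT _ _).1.
      exact: measurable_itv.
    by apply: measurable_funTS; exact: continuous_measurable_fun.
  - move=> y _; apply: cvg_near_cst; near=> n.
    rewrite /f patchE ifT//; apply/mem_set; rewrite /I/= in_itv/=.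
    have : `|y| <= n%:R by near: n; exact: nbhs_infty_ger.
    by rewrite ler_norml.
  - exact: integrable_abse.
  - move=> n y _; rewrite /f patchE; case: ifP => // _.
    by rewrite [point](_ : _ = 0)//= normr0 lee_fin.
have cvg0 : (\int[leb]_y f n y)%E @[n --> \oo] --> 0%E.
  have E n : (\int[leb]_y f n.+1 y)%E = (H n.+1%:R - H (- n.+1%:R))%:E.
    rewrite EFinB -(@continuous_FTC2 R h H (- n.+1%:R) n.+1%:R).
    - rewrite [RHS]integral_mkcond; apply: eq_integral => y _.
      by rewrite /f !patchE; case: ifP.
    - by rewrite gtrN.
    - exact: continuous_subspaceT.
    - have cH : continuous H by exact: is_derive_continuous dH.
      split.
      + by move=> x _; have [] := dH x.
      + exact/cvg_at_right_filter/cH.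
      + exact/cvg_at_left_filter/cH.
    - by move=> y _; rewrite derive1E; have [_ ->] := dH y.
  rewrite -(cvg_shiftS (fun n => (\int[leb]_y f n y)%E)).
  rewrite (_ : [sequence _]_n = fun n => (H n.+1%:R - H (- n.+1%:R))%:E); last first.
    by apply/funext => n; rewrite -E.
  apply: cvg_EFin; first exact: nearW.
  pose K := C * (1 + 2 / a) * (2 / a).
  have Hle n (y : R) : `|y| = n.+1%:R -> `|H y| <= K * n.+1%:R^-1.
    move=> yn; have y2 : y ^+ 2 = n.+1%:R ^+ 2 by rewrite -yn real_normK// num_real.
    have C0 : 0 <= C.
      have := le_trans (normr_ge0 _) (Hb 0).
      by rewrite !expr0n/= addr0 mul1r mulr0 expR0 mulr1.
    rewrite (le_trans (Hb y))// /K -!mulrA ler_wpM2l//.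
    rewrite (le_trans (gauss_tail a0 y))// ler_wpM2l ?addr_ge0 ?divr_ge0 ?(ltW a0)//.
    have -> : 2 * (a^-1 / n.+1%:R) = (a / 2 * n.+1%:R)^-1.
      by rewrite !invfM invrK mulrA [2 * _]mulrC.
    rewrite mulNr expRN lef_pV2 ?posrE ?expR_gt0//; last first.
      by rewrite mulr_gt0// divr_gt0.
    apply: le_trans (expR_ge1Dx _); rewrite y2.
    rewrite (@le_trans _ _ (a / 2 * n.+1%:R ^+ 2))//; last by rewrite lerDr.
    by rewrite ler_wpM2l ?divr_ge0 ?(ltW a0)// expr2 ler_peMl// ler1n.
  apply: norm_cvg0.
  apply: (@squeeze_cvgr _ _ _ _ (cst 0) (fun n => (2 * K) * n.+1%:R^-1)).
  - apply: nearW => n /=; rewrite normr_ge0/= (le_trans (ler_normB _ _))//.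
    by rewrite -mulrA mulr_natl mulr2n lerD// Hle// ?normrN ger0_norm.
  - exact: cvg_cst.
  - rewrite -[X in _ --> X](mulr0 (2 * K)); by apply: cvgM; [exact: cvg_cst|exact: cvg_harmonic].
by rewrite /Rintegral -(cvg_lim _ cvgf)// (cvg_lim _ cvg0).
Unshelve. all: end_near. Qed.

End gauss_weight.

(** The integral of exp(-a y^2) exp(i (x y - tau y^2)) is computed along the ray
r -> (r x, r tau): with p(y) = x y - tau y^2, the integrals C 0 r and S 0 r of
exp(-a y^2) cos(r p(y)) and exp(-a y^2) sin(r p(y)) satisfy a linear differential
equation in r, and at r = 0 the integral is the classical one.  This replaces the
analytic continuation in a. *)
Section oscillatory_gaussian.
Context (R : realType).
Notation leb := (@lebesgue_measure R).
Variables (a x tau : R).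
Hypothesis a0 : 0 < a.

Let w (y : R) := expR (- a * y ^+ 2).
Let p (y : R) := x * y - tau * y ^+ 2.

Let dw (y : R) : is_derive y 1 w (- 2 * a * y * w y).
Proof. by derive1; rewrite /w; ring. Qed.

Let dp (y : R) : is_derive y 1 p (x - 2 * tau * y).
Proof. by derive1; ring. Qed.

Let drp (r y : R) : is_derive y 1 (fun y => r * p y) (r * (x - 2 * tau * y)).
Proof. by derive1; ring. Qed.

Let dcos (r y : R) : is_derive y 1 (fun y => cos (r * p y))
  (- (r * (x - 2 * tau * y)) * sin (r * p y)).
Proof. by have := drp r y => h; derive1; ring. Qed.

Let dsin (r y : R) : is_derive y 1 (fun y => sin (r * p y))
  (r * (x - 2 * tau * y) * cos (r * p y)).
Proof. by have := drp r y => h; derive1; ring. Qed.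

Let pow_le (k : nat) (y : R) : (k <= 2)%N -> `|y ^+ k| <= 1 + y ^+ 2.
Proof.
case: k => [|[|[|]]]// _.
- by rewrite expr0 normr1 lerDl sqr_ge0.
- rewrite expr1 -real_normK ?num_real//.
  have := sqr_ge0 (`|y| - 1); have := normr_ge0 y; nra.
- by rewrite ger0_norm ?sqr_ge0// lerDr.
Qed.

Let bound (k : nat) (f : R -> R) : (k <= 2)%N -> (forall y, `|f y| <= 1) ->
  forall y, `|y ^+ k * (w y * f y)| <= 1 * ((1 + y ^+ 2) * expR (- a * y ^+ 2)).
Proof.
move=> k2 f1 y; rewrite mul1r !normrM ler_pM ?mulr_ge0// ?pow_le//.
by rewrite ger0_norm ?expR_ge0// ler_piMr ?expR_ge0.
Qed.

Let cw : continuous w. Proof. exact: is_derive_continuous dw. Qed.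

Let cp : continuous p. Proof. exact: is_derive_continuous dp. Qed.

Let ccos r : continuous (fun y => cos (r * p y)).
Proof. exact: is_derive_continuous (dcos r). Qed.

Let csin r : continuous (fun y => sin (r * p y)).
Proof. exact: is_derive_continuous (dsin r). Qed.

Let cpow k (f : R -> R) : continuous f -> continuous (fun y : R => y ^+ k * (w y * f y)).
Proof.
move=> cf y; apply: cvgM; first exact: exprn_continuous.
by apply: cvgM; [exact: cw|exact: cf].
Qed.

Let C k r := \int[leb]_y (y ^+ k * (w y * cos (r * p y))).
Let S k r := \int[leb]_y (y ^+ k * (w y * sin (r * p y))).

Let iC k r : (k <= 2)%N ->
  leb.-integrable setT (fun y => (y ^+ k * (w y * cos (r * p y)))%:E).
Proof.
move=> k2; apply: (gauss_dominated a0); first exact/cpow/ccos.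
by apply: bound => // y; exact: cos_max.
Qed.

Let iS k r : (k <= 2)%N ->
  leb.-integrable setT (fun y => (y ^+ k * (w y * sin (r * p y)))%:E).
Proof.
move=> k2; apply: (gauss_dominated a0); first exact/cpow/csin.
by apply: bound => // y; exact: sin_max.
Qed.

Let iZ (c : R) (f : R -> R) : leb.-integrable setT (fun y => (f y)%:E) ->
  leb.-integrable setT (fun y => (c * f y)%:E).
Proof. by move=> h; under eq_fun do rewrite EFinM; exact: integrableZl. Qed.

Let iD (f g : R -> R) : leb.-integrable setT (fun y => (f y)%:E) ->
  leb.-integrable setT (fun y => (g y)%:E) ->
  leb.-integrable setT (fun y => (f y + g y)%:E).
Proof. by move=> hf hg; under eq_fun do rewrite EFinD; exact: integrableD. Qed.

Let comb3 (c1 c2 c3 : R) (f g h : R -> R) :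
  leb.-integrable setT (fun y => (f y)%:E) ->
  leb.-integrable setT (fun y => (g y)%:E) ->
  leb.-integrable setT (fun y => (h y)%:E) ->
  leb.-integrable setT (fun y => (c1 * f y + c2 * g y + c3 * h y)%:E) /\
  \int[leb]_y (c1 * f y + c2 * g y + c3 * h y) =
  c1 * \int[leb]_y f y + c2 * \int[leb]_y g y + c3 * \int[leb]_y h y.
Proof.
move=> hf hg hh; split; first by apply: iD; [apply: iD|]; exact: iZ.
rewrite RintegralD//; [|by apply: iD; exact: iZ|exact: iZ].
rewrite RintegralD//; [|exact: iZ|exact: iZ].
by rewrite !RintegralZl.
Qed.

(** The integrals of the derivatives of w cos(r p), w sin(r p), y w cos(r p) and
   y w sin(r p) vanish.  These four relations express the moments of order 1 and
   2 through those of order 0. *)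
Let ibp_C0 r : - (2 * a) * C 1 r + - (r * x) * S 0 r + 2 * r * tau * S 1 r = 0.
Proof.
have [ic <-] := comb3 (- (2 * a)) (- (r * x)) (2 * r * tau)
  (iC r (isT : 1 <= 2)%N) (iS r (isT : 0 <= 2)%N) (iS r (isT : 1 <= 2)%N).
apply: (@integral_derivative_eq0 _ a a0 (fun y => y ^+ 0 * (w y * cos (r * p y))) _ 1) => //.
- move=> y; have := dw y => h; have := dcos r y => h2.
  by rewrite (_ : (fun y => _) = (fun y => w y * cos (r * p y)));
    [derive1; ring|apply/funext => z; rewrite expr0 mul1r].
- by move=> y; apply: cvgD; [apply: cvgD|]; (apply: cvgM; first exact: cvg_cst);
    apply: cpow; (exact: ccos || exact: csin).
- by apply: bound => // y; exact: cos_max.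
Qed.

Let ibp_S0 r : - (2 * a) * S 1 r + r * x * C 0 r + - (2 * r * tau) * C 1 r = 0.
Proof.
have [ic <-] := comb3 (- (2 * a)) (r * x) (- (2 * r * tau))
  (iS r (isT : 1 <= 2)%N) (iC r (isT : 0 <= 2)%N) (iC r (isT : 1 <= 2)%N).
apply: (@integral_derivative_eq0 _ a a0 (fun y => y ^+ 0 * (w y * sin (r * p y))) _ 1) => //.
- move=> y; have := dw y => h; have := dsin r y => h2.
  by rewrite (_ : (fun y => _) = (fun y => w y * sin (r * p y)));
    [derive1; ring|apply/funext => z; rewrite expr0 mul1r].
- by move=> y; apply: cvgD; [apply: cvgD|]; (apply: cvgM; first exact: cvg_cst);
    apply: cpow; (exact: ccos || exact: csin).
- by apply: bound => // y; exact: sin_max.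
Qed.

Let ibp_C1 r : C 0 r + - (2 * a) * C 2 r + - (r * x) * S 1 r + 2 * r * tau * S 2 r = 0.
Proof.
have [ic Ec] := comb3 1 (- (2 * a)) (- (r * x))
  (iC r (isT : 0 <= 2)%N) (iC r (isT : 2 <= 2)%N) (iS r (isT : 1 <= 2)%N).
have [ic' Ec'] := comb3 1 (2 * r * tau) 0 ic (iS r (isT : 2 <= 2)%N) (iS r (isT : 2 <= 2)%N).
have <- : 1 * (1 * C 0 r + - (2 * a) * C 2 r + - (r * x) * S 1 r) +
  2 * r * tau * S 2 r + 0 * S 2 r =
  C 0 r + - (2 * a) * C 2 r + - (r * x) * S 1 r + 2 * r * tau * S 2 r by ring.
rewrite -Ec -Ec'.
apply: (@integral_derivative_eq0 _ a a0 (fun y => y ^+ 1 * (w y * cos (r * p y))) _ 1) => //.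
- move=> y; have := dw y => h; have := dcos r y => h2.
  by rewrite (_ : (fun y => _) = (fun y => y * (w y * cos (r * p y))));
    [derive1; ring|apply/funext => z; rewrite expr1].
- move=> y; apply: cvgD; [apply: cvgD|]; (apply: cvgM; first exact: cvg_cst);
    try (by apply: cpow; (exact: ccos || exact: csin)).
  by apply: cvgD; [apply: cvgD|]; (apply: cvgM; first exact: cvg_cst);
    apply: cpow; (exact: ccos || exact: csin).
- by apply: bound => // y; exact: cos_max.
Qed.

Let ibp_S1 r : S 0 r + - (2 * a) * S 2 r + r * x * C 1 r + - (2 * r * tau) * C 2 r = 0.
Proof.
have [ic Ec] := comb3 1 (- (2 * a)) (r * x)
  (iS r (isT : 0 <= 2)%N) (iS r (isT : 2 <= 2)%N) (iC r (isT : 1 <= 2)%N).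
have [ic' Ec'] := comb3 1 (- (2 * r * tau)) 0 ic (iC r (isT : 2 <= 2)%N) (iC r (isT : 2 <= 2)%N).
have <- : 1 * (1 * S 0 r + - (2 * a) * S 2 r + r * x * C 1 r) +
  - (2 * r * tau) * C 2 r + 0 * C 2 r =
  S 0 r + - (2 * a) * S 2 r + r * x * C 1 r + - (2 * r * tau) * C 2 r by ring.
rewrite -Ec -Ec'.
apply: (@integral_derivative_eq0 _ a a0 (fun y => y ^+ 1 * (w y * sin (r * p y))) _ 1) => //.
- move=> y; have := dw y => h; have := dsin r y => h2.
  by rewrite (_ : (fun y => _) = (fun y => y * (w y * sin (r * p y))));
    [derive1; ring|apply/funext => z; rewrite expr1].
- move=> y; apply: cvgD; [apply: cvgD|]; (apply: cvgM; first exact: cvg_cst);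
    try (by apply: cpow; (exact: ccos || exact: csin)).
  by apply: cvgD; [apply: cvgD|]; (apply: cvgM; first exact: cvg_cst);
    apply: cpow; (exact: ccos || exact: csin).
- by apply: bound => // y; exact: sin_max.
Qed.

Let dbound (f : R -> R) y : `|f y| <= 1 ->
  `|p y * (w y * f y)| <= (`|x| + `|tau|) * ((1 + y ^+ 2) * w y).
Proof.
move=> f1; rewrite normrM mulrA ler_pM//.
  rewrite (le_trans (ler_normB _ _))// !normrM mulrDl lerD// ler_wpM2l//.
    exact: (@pow_le 1).
  by rewrite -normrM; exact: (@pow_le 2).
by rewrite normrM ger0_norm ?expR_ge0// ler_piMr ?expR_ge0.
Qed.

Let idom : leb.-integrable setT
  (EFin \o (fun y => (`|x| + `|tau|) * ((1 + y ^+ 2) * w y))).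
Proof.
apply: (gauss_dominated a0 (C := `|x| + `|tau|)).
  move=> y; apply: cvgM; first exact: cvg_cst.
  apply: cvgM; last exact: cw.
  by apply: cvgD; [exact: cvg_cst|exact: exprn_continuous].
by move=> y; rewrite ger0_norm// !mulr_ge0 ?addr_ge0 ?sqr_ge0 ?expR_ge0.
Qed.

(** Differentiation under the integral sign brings down p(y), hence moments of
   order 1 and 2. *)
Let dC (r : R) : is_derive r (1 : R) (C 0) (- x * S 1 r + tau * S 2 r).
Proof.
pose f (r y : R) : R := y ^+ 0 * (w y * cos (r * p y)).
have df (r' y : R) : is_derive r' 1 (f ^~ y) (- (p y * (w y * sin (r' * p y)))).
  by rewrite (_ : f ^~ y = (fun r => w y * cos (r * p y)));
    [derive1; ring|apply/funext => z; rewrite /f expr0 mul1r].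
have Ir : `](r - 1), (r + 1)[%classic r.
  by rewrite /= in_itv/= ltrBlDr !ltrDl ltr01.
have G0 y : 0 <= (`|x| + `|tau|) * ((1 + y ^+ 2) * w y).
  by rewrite !mulr_ge0 ?addr_ge0 ?sqr_ge0 ?expR_ge0.
have int_f r' : `](r - 1), (r + 1)[%classic r' ->
   leb.-integrable setT (EFin \o f r') by move=> _; exact: iC.
have der_f r' y : `](r - 1), (r + 1)[%classic r' -> [set: R] y ->
   derivable (f ^~ y) r' 1 by move=> _ _; have [] := df r' y.
have ub r' y : `](r - 1), (r + 1)[%classic r' -> [set: R] y ->
   `|partial1of2 f r' y| <= (`|x| + `|tau|) * ((1 + y ^+ 2) * w y).
  move=> _ _; rewrite partial1of2E (@derive_val _ _ _ _ _ _ _ (df r' y)) normrN.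
  by apply: (dbound (f := fun y => sin (r' * p y))); exact: sin_max.
apply: DeriveDef.
  exact: (derivable_under_integral measurableT Ir int_f der_f G0 idom ub).
rewrite -derive1E (differentiation_under_integral measurableT Ir int_f der_f G0 idom ub).
have [_] := comb3 (- x) tau 0 (iS r (isT : 1 <= 2)%N) (iS r (isT : 2 <= 2)%N)
  (iS r (isT : 2 <= 2)%N).
rewrite mul0r addr0 => <-; apply: eq_Rintegral => y _.
by rewrite partial1of2E (@derive_val _ _ _ _ _ _ _ (df r y)) /p; ring.
Qed.

Let dS (r : R) : is_derive r (1 : R) (S 0) (x * C 1 r - tau * C 2 r).
Proof.
pose f (r y : R) : R := y ^+ 0 * (w y * sin (r * p y)).
have df (r' y : R) : is_derive r' 1 (f ^~ y) (p y * (w y * cos (r' * p y))).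
  by rewrite (_ : f ^~ y = (fun r => w y * sin (r * p y)));
    [derive1; ring|apply/funext => z; rewrite /f expr0 mul1r].
have Ir : `](r - 1), (r + 1)[%classic r.
  by rewrite /= in_itv/= ltrBlDr !ltrDl ltr01.
have G0 y : 0 <= (`|x| + `|tau|) * ((1 + y ^+ 2) * w y).
  by rewrite !mulr_ge0 ?addr_ge0 ?sqr_ge0 ?expR_ge0.
have int_f r' : `](r - 1), (r + 1)[%classic r' ->
   leb.-integrable setT (EFin \o f r') by move=> _; exact: iS.
have der_f r' y : `](r - 1), (r + 1)[%classic r' -> [set: R] y ->
   derivable (f ^~ y) r' 1 by move=> _ _; have [] := df r' y.
have ub r' y : `](r - 1), (r + 1)[%classic r' -> [set: R] y ->
   `|partial1of2 f r' y| <= (`|x| + `|tau|) * ((1 + y ^+ 2) * w y).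
  move=> _ _; rewrite partial1of2E (@derive_val _ _ _ _ _ _ _ (df r' y)).
  by apply: (dbound (f := fun y => cos (r' * p y))); exact: cos_max.
apply: DeriveDef.
  exact: (derivable_under_integral measurableT Ir int_f der_f G0 idom ub).
rewrite -derive1E (differentiation_under_integral measurableT Ir int_f der_f G0 idom ub).
have [_] := comb3 x (- tau) 0 (iC r (isT : 1 <= 2)%N) (iC r (isT : 2 <= 2)%N)
  (iC r (isT : 2 <= 2)%N).
rewrite mul0r addr0 mulNr => <-; apply: eq_Rintegral => y _.
by rewrite partial1of2E (@derive_val _ _ _ _ _ _ _ (df r y)) /p; ring.
Qed.

(** D is the squared modulus of a + i r tau, and up to a factor 4 the determinant of
   the linear systems solved below. *)
Let D r := a ^+ 2 + r ^+ 2 * tau ^+ 2.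

Let D_gt0 r : 0 < D r.
Proof. by rewrite ltr_wpDr ?exprn_gt0// mulr_ge0 ?sqr_ge0. Qed.

(** Z = C 0 + i S 0 satisfies Z' = (lr + i li) Z. *)
Let lr r := - (r * tau ^+ 2) / (2 * D r) - a ^+ 3 * x ^+ 2 * r / (2 * D r ^+ 2).
Let li r := - (a * tau) / (2 * D r)
  + x ^+ 2 * tau / 4 * ((3 * r ^+ 2 * D r - 2 * r ^+ 4 * tau ^+ 2) / D r ^+ 2).

Let C1E r : C 1 r = (r ^+ 2 * x * tau * C 0 r - r * x * a * S 0 r) / (2 * D r).
Proof.
have Dn0 := lt0r_neq0 (D_gt0 r).
have e1 := ibp_C0 r; have e2 := ibp_S0 r.
apply: (canRL (mulfK _)); first by rewrite mulf_neq0.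
apply/eqP; rewrite -subr_eq0; apply/eqP.
rewrite (_ : _ - _ = - a * (- (2 * a) * C 1 r + - (r * x) * S 0 r + 2 * r * tau * S 1 r)
  - r * tau * (- (2 * a) * S 1 r + r * x * C 0 r + - (2 * r * tau) * C 1 r)).
  by rewrite e1 e2 !mulr0 subr0.
by rewrite /D; ring.
Qed.

Let S1E r : S 1 r = (r ^+ 2 * x * tau * S 0 r + r * x * a * C 0 r) / (2 * D r).
Proof.
have Dn0 := lt0r_neq0 (D_gt0 r).
have e1 := ibp_C0 r; have e2 := ibp_S0 r.
apply: (canRL (mulfK _)); first by rewrite mulf_neq0.
apply/eqP; rewrite -subr_eq0; apply/eqP.
rewrite (_ : _ - _ = r * tau * (- (2 * a) * C 1 r + - (r * x) * S 0 r + 2 * r * tau * S 1 r)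
  - a * (- (2 * a) * S 1 r + r * x * C 0 r + - (2 * r * tau) * C 1 r)).
  by rewrite e1 e2 !mulr0 subr0.
by rewrite /D; ring.
Qed.

Let C2E r : C 2 r = (a * (C 0 r - r * x * S 1 r) + r * tau * (S 0 r + r * x * C 1 r)) / (2 * D r).
Proof.
have Dn0 := lt0r_neq0 (D_gt0 r).
have e1 := ibp_C1 r; have e2 := ibp_S1 r.
apply: (canRL (mulfK _)); first by rewrite mulf_neq0.
apply/eqP; rewrite -subr_eq0; apply/eqP.
rewrite (_ : _ - _ = - a * (C 0 r + - (2 * a) * C 2 r + - (r * x) * S 1 r + 2 * r * tau * S 2 r)
  - r * tau * (S 0 r + - (2 * a) * S 2 r + r * x * C 1 r + - (2 * r * tau) * C 2 r)).
  by rewrite e1 e2 !mulr0 subr0.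
by rewrite /D; ring.
Qed.

Let S2E r : S 2 r = (a * (S 0 r + r * x * C 1 r) - r * tau * (C 0 r - r * x * S 1 r)) / (2 * D r).
Proof.
have Dn0 := lt0r_neq0 (D_gt0 r).
have e1 := ibp_C1 r; have e2 := ibp_S1 r.
apply: (canRL (mulfK _)); first by rewrite mulf_neq0.
apply/eqP; rewrite -subr_eq0; apply/eqP.
rewrite (_ : _ - _ = r * tau * (C 0 r + - (2 * a) * C 2 r + - (r * x) * S 1 r + 2 * r * tau * S 2 r)
  - a * (S 0 r + - (2 * a) * S 2 r + r * x * C 1 r + - (2 * r * tau) * C 2 r)).
  by rewrite e1 e2 !mulr0 subr0.
by rewrite /D; ring.
Qed.

Let dC' (r : R) : is_derive r (1 : R) (C 0) (lr r * C 0 r - li r * S 0 r).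
Proof.
refine (@is_derive_eq _ _ _ _ _ _ _ _ (dC r) _); rewrite S2E C1E S1E /lr /li.
have := lt0r_neq0 (D_gt0 r); rewrite /D => Dn0.
by field; rewrite exprMn.
Qed.

Let dS' (r : R) : is_derive r (1 : R) (S 0) (li r * C 0 r + lr r * S 0 r).
Proof.
refine (@is_derive_eq _ _ _ _ _ _ _ _ (dS r) _); rewrite C2E C1E S1E /lr /li.
have := lt0r_neq0 (D_gt0 r); rewrite /D => Dn0.
by field; rewrite exprMn.
Qed.

(** - phi and B are primitives of lr and li, so that P + i Q = exp(phi - i B) Z is
   constant. *)
Let phi r := ln (D r) / 4 + a * x ^+ 2 * r ^+ 2 / (4 * D r).
Let B r := r ^+ 3 * x ^+ 2 * tau / (4 * D r) - atan (r * tau / a) / 2.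

Let dD (r : R) : is_derive r (1 : R) D (2 * r * tau ^+ 2).
Proof. by derive1; ring. Qed.

Let dDV (r : R) : is_derive r (1 : R) (fun r => (D r)^-1) (- (2 * r * tau ^+ 2) / D r ^+ 2).
Proof.
have h := is_deriveV (lt0r_neq0 (D_gt0 r)) (dD r).
by refine (@is_derive_eq _ _ _ _ _ _ _ _ h _); rewrite /GRing.scale/=; ring.
Qed.

Let dlnD (r : R) : is_derive r (1 : R) (fun r => ln (D r)) (2 * r * tau ^+ 2 / D r).
Proof.
have h := @is_derive1_comp R (@ln R) D r _ _ (is_derive1_ln (D_gt0 r)) (dD r).
by refine (@is_derive_eq _ _ _ _ _ _ _ _ h _); rewrite mulrC.
Qed.

Let dphi (r : R) : is_derive r (1 : R) phi (- lr r).
Proof.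
have h1 := dlnD r; have h2 := dDV r.
have -> : phi = fun r => ln (D r) * 4^-1 + a * x ^+ 2 / 4 * r ^+ 2 * (D r)^-1.
  apply/funext => z; have := lt0r_neq0 (D_gt0 z); rewrite /phi => Dn0; by field.
derive1.
have := lt0r_neq0 (D_gt0 r); rewrite /lr /D => Dn0.
by field; rewrite exprMn.
Qed.

Let dB (r : R) : is_derive r (1 : R) B (li r).
Proof.
have h2 := dDV r.
have an0 := lt0r_neq0 a0.
have -> : B = fun r => x ^+ 2 * tau / 4 * r ^+ 3 * (D r)^-1 - 2^-1 * atan (tau / a * r).
  apply/funext => z; have := lt0r_neq0 (D_gt0 z); rewrite /B => Dn0.
  have -> : z * tau / a = tau / a * z by rewrite mulrAC mulrC mulrA mulrAC.
  by field.
derive1.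
have := lt0r_neq0 (D_gt0 r); rewrite /li /D => Dn0.
by field; rewrite exprMn Dn0 an0.
Qed.

Let P r := expR (phi r) * (cos (B r) * C 0 r + sin (B r) * S 0 r).
Let Q r := expR (phi r) * (cos (B r) * S 0 r - sin (B r) * C 0 r).

Let dP (r : R) : is_derive r (1 : R) P 0.
Proof.
have h1 := dphi r; have h2 := dB r; have h3 := dC' r; have h4 := dS' r.
by derive1; ring.
Qed.

Let dQ (r : R) : is_derive r (1 : R) Q 0.
Proof.
have h1 := dphi r; have h2 := dB r; have h3 := dC' r; have h4 := dS' r.
by derive1; ring.
Qed.

Let B0 : B 0 = 0.
Proof. by rewrite /B expr0n/= !mul0r atan0 mul0r subr0. Qed.

Let C00 : C 0 0 = Num.sqrt (pi / a).
Proof.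
have [_ <-] := integral_gaussian a0 0; apply: eq_Rintegral => y _.
by rewrite subr0 mul0r cos0 expr0 mul1r mulr1.
Qed.

Let S00 : S 0 0 = 0.
Proof.
rewrite /S; under eq_Rintegral do rewrite mul0r sin0 !mulr0.
by rewrite Rintegral_cst// mul0r.
Qed.

Let modulus := Num.sqrt (pi / a) * expR (phi 0 - phi 1).

Let polar : C 0 1 = modulus * cos (B 1) /\ S 0 1 = modulus * sin (B 1).
Proof.
have P1 : P 1 = expR (phi 0) * Num.sqrt (pi / a).
  by rewrite (is_derive_0_is_cst 1 0 dP) /P B0 cos0 sin0 C00 S00; ring.
have Q1 : Q 1 = 0.
  by rewrite (is_derive_0_is_cst 1 0 dQ) /Q B0 cos0 sin0 C00 S00; ring.
have cs := cos2Dsin2 (B 1).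
have e1 : C 0 1 = expR (- phi 1) * (cos (B 1) * P 1 - sin (B 1) * Q 1).
  transitivity (C 0 1 * (cos (B 1) ^+ 2 + sin (B 1) ^+ 2) * (expR (- phi 1) * expR (phi 1))).
    by rewrite cs -expRD addNr expR0 !mulr1.
  by rewrite /P /Q; ring.
have e2 : S 0 1 = expR (- phi 1) * (sin (B 1) * P 1 + cos (B 1) * Q 1).
  transitivity (S 0 1 * (cos (B 1) ^+ 2 + sin (B 1) ^+ 2) * (expR (- phi 1) * expR (phi 1))).
    by rewrite cs -expRD addNr expR0 !mulr1.
  by rewrite /P /Q; ring.
rewrite e1 e2 P1 Q1 /modulus (expRD (phi 0) (- phi 1)).
by split; ring.
Qed.

Lemma oscillatory_gaussian_integral :
  let z2 := a ^+ 2 + tau ^+ 2 in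
  let m := Num.sqrt (pi / a) * expR (ln (a ^+ 2) / 4 - ln z2 / 4 - a * x ^+ 2 / (4 * z2)) in
  let b := x ^+ 2 * tau / (4 * z2) - atan (tau / a) / 2 in
  [/\ leb.-integrable setT (fun y => (expR (- a * y ^+ 2) * cos (x * y - tau * y ^+ 2))%:E),
      leb.-integrable setT (fun y => (expR (- a * y ^+ 2) * sin (x * y - tau * y ^+ 2))%:E),
      \int[leb]_y (expR (- a * y ^+ 2) * cos (x * y - tau * y ^+ 2)) = m * cos b &
      \int[leb]_y (expR (- a * y ^+ 2) * sin (x * y - tau * y ^+ 2)) = m * sin b].
Proof.
move=> z2 m b.
have D1 : D 1 = z2 by rewrite /D expr1n mul1r.
have mE : modulus = m.
  rewrite /modulus /m /phi D1 {1}/D expr0n/= !(mul0r, mulr0) addr0 expr1n mulr1 addr0.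
  by rewrite opprD addrA.
have bE : B 1 = b by rewrite /B D1 !expr1n !mul1r.
have [c1 s1] := polar; rewrite mE bE in c1 s1.
have e (f : R -> R) y : y ^+ 0 * (w y * f (1 * p y)) =
    expR (- a * y ^+ 2) * f (x * y - tau * y ^+ 2) by rewrite expr0 !mul1r.
split.
- by have := iC 1 (isT : 0 <= 2)%N; under eq_fun do rewrite (e cos).
- by have := iS 1 (isT : 0 <= 2)%N; under eq_fun do rewrite (e sin).
- by rewrite -c1; apply: eq_Rintegral => y _; rewrite (e cos).
- by rewrite -s1; apply: eq_Rintegral => y _; rewrite (e sin).
Qed.

End oscillatory_gaussian.

(** * Complex integrals and product integrands *)
Section complex_integrals.
Context (R : realType).
Local Notation C := (R[i]).
Notation leb := (@lebesgue_measure R).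

Definition Cintegrable d (T : measurableType d) (mu : {measure set T -> \bar R})
    (f : T -> C) :=
  mu.-integrable setT (fun x => (complex.Re (f x))%:E) /\
  mu.-integrable setT (fun x => (complex.Im (f x))%:E).

Lemma ReM (z w : C) : complex.Re (z * w) =
  complex.Re z * complex.Re w - complex.Im z * complex.Im w.
Proof. by case: z => a b; case: w => c d. Qed.

Lemma ImM (z w : C) : complex.Im (z * w) =
  complex.Re z * complex.Im w + complex.Im z * complex.Re w.
Proof. by case: z => a b; case: w => c d. Qed.

Lemma ReD (z w : C) : complex.Re (z + w) = complex.Re z + complex.Re w.
Proof. by case: z => a b; case: w => c d. Qed.

Lemma ImD (z w : C) : complex.Im (z + w) = complex.Im z + complex.Im w.
Proof. by case: z => a b; case: w => c d. Qed.

Lemma complex_ext (z w : C) :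
  complex.Re z = complex.Re w -> complex.Im z = complex.Im w -> z = w.
Proof. by case: z => a b; case: w => c d /= -> ->. Qed.

Section integrals.
Context d (T : measurableType d) (mu : {measure set T -> \bar R}).

Let iZ (D : set T) (c : R) (f : T -> R) : measurable D ->
  mu.-integrable D (fun y => (f y)%:E) ->
  mu.-integrable D (fun y => (c * f y)%:E).
Proof. by move=> mD h; under eq_fun do rewrite EFinM; exact: integrableZl. Qed.

Lemma integrable_comb (D : set T) (c1 c2 : R) (f g : T -> R) : measurable D ->
  mu.-integrable D (fun y => (f y)%:E) ->
  mu.-integrable D (fun y => (g y)%:E) ->
  mu.-integrable D (fun y => (c1 * f y + c2 * g y)%:E) /\
  \int[mu]_(y in D) (c1 * f y + c2 * g y) =
  c1 * \int[mu]_(y in D) f y + c2 * \int[mu]_(y in D) g y.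
Proof.
move=> mD hf hg; split.
  under eq_fun do rewrite EFinD; apply: integrableD => //; exact: iZ.
by rewrite RintegralD//; [rewrite !RintegralZl|exact: iZ|exact: iZ].
Qed.

Lemma CintegralZ (c : C) (f : T -> C) : Cintegrable mu f ->
  Cintegrable mu (fun x => c * f x) /\
  Cintegral mu setT (fun x => c * f x) = c * Cintegral mu setT f.
Proof.
move=> [fr fi].
have [i1 e1] := integrable_comb (complex.Re c) (- complex.Im c) measurableT fr fi.
have [i2 e2] := integrable_comb (complex.Re c) (complex.Im c) measurableT fi fr.
have r1 x : complex.Re (c * f x) = complex.Re c * complex.Re (f x) +
  - complex.Im c * complex.Im (f x) by rewrite ReM mulNr.
have r2 x : complex.Im (c * f x) = complex.Re c * complex.Im (f x) +
  complex.Im c * complex.Re (f x) by rewrite ImM.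
split.
  split; first by under eq_fun do rewrite r1.
  by under eq_fun do rewrite r2.
apply: complex_ext.
  rewrite ReM /=; under eq_Rintegral do rewrite r1.
  by rewrite e1 mulNr.
rewrite ImM /=; under eq_Rintegral do rewrite r2.
by rewrite e2.
Qed.

Lemma CintegralD (f g : T -> C) : Cintegrable mu f -> Cintegrable mu g ->
  Cintegrable mu (fun x => f x + g x) /\
  Cintegral mu setT (fun x => f x + g x) = Cintegral mu setT f + Cintegral mu setT g.
Proof.
move=> [fr fi] [gr gi].
split.
  split; under eq_fun do rewrite ?ReD ?ImD EFinD; exact: integrableD.
apply: complex_ext; rewrite ?ReD ?ImD /= -RintegralD//.
  by apply: eq_Rintegral => x _; rewrite ReD.
by apply: eq_Rintegral => x _; rewrite ImD.
Qed.

Lemma Cintegral0 : Cintegrable mu (fun=> 0) /\ Cintegral mu setT (fun=> 0) = 0.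
Proof.
split; first by split; exact: integrable0.
by apply: complex_ext; rewrite /= /Rintegral integral0.
Qed.

Lemma Cintegral_sum (I : Type) (s : seq I) (P : pred I) (c : I -> C) (f : I -> T -> C) :
  (forall k, P k -> Cintegrable mu (f k)) ->
  Cintegrable mu (fun x => \sum_(k <- s | P k) c k * f k x) /\
  Cintegral mu setT (fun x => \sum_(k <- s | P k) c k * f k x) =
  \sum_(k <- s | P k) c k * Cintegral mu setT (f k).
Proof.
move=> fI; elim: s => [|k s [IH1 IH2]].
  rewrite big_nil (_ : (fun x => _) = (fun=> 0)); first exact: Cintegral0.
  by apply/funext => x; rewrite big_nil.
rewrite big_cons; case: ifPn => Pk; last first.
  rewrite (_ : (fun x => _) = (fun x => \sum_(j <- s | P j) c j * f j x))//.
  by apply/funext => x; rewrite big_cons (negbTE Pk).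
have [z1 z2] := CintegralZ (c k) (fI k Pk).
rewrite (_ : (fun x => _) =
  (fun x => c k * f k x + \sum_(j <- s | P j) c j * f j x)); last first.
  by apply/funext => x; rewrite big_cons Pk.
by have [d1 d2] := CintegralD z1 IH1; split => //; rewrite d2 z2 IH2.
Qed.

End integrals.

Section product.
Context d1 d2 (T1 : measurableType d1) (T2 : measurableType d2).
Variable m1 : {sigma_finite_measure set T1 -> \bar R}.
Variable m2 : {sigma_finite_measure set T2 -> \bar R}.

Lemma Rintegral_tensor (f : T1 -> R) (g : T2 -> R) :
  m1.-integrable setT (fun x => (f x)%:E) ->
  m2.-integrable setT (fun x => (g x)%:E) ->
  (m1 \x m2)%E.-integrable setT (fun z => (f z.1 * g z.2)%:E) /\
  \int[(m1 \x m2)%E]_z (f z.1 * g z.2) = \int[m1]_x f x * \int[m2]_y g y.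
Proof.
move=> hf hg.
have mf : measurable_fun setT f by have /integrableP[/measurable_EFinP] := hf.
have mg : measurable_fun setT g by have /integrableP[/measurable_EFinP] := hg.
have i : (m1 \x m2)%E.-integrable setT (fun z => (f z.1 * g z.2)%:E).
  apply/integrable12ltyP.
    apply/measurable_EFinP; apply: measurable_funM.
      exact: measurableT_comp mf measurable_fst.
    exact: measurableT_comp mg measurable_snd.
  rewrite (eq_integral (fun x => `|f x|%:E * \int[m2]_y `|g y|%:E)%E); last first.
    move=> x _ /=; rewrite -ge0_integralZl_EFin//.
    - by apply: eq_integral => y _; rewrite -EFinM normrM.
    - by apply/measurable_EFinP; exact: measurableT_comp.
  rewrite ge0_integralZr//.
  - have /integrableP[_ f1] := hf; have /integrableP[_ g1] := hg.
    rewrite lte_mul_pinfty//.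
    + by apply: integral_ge0 => x _; rewrite lee_fin.
    + by rewrite ge0_fin_numE//; apply: integral_ge0 => x _; rewrite lee_fin.
  - by apply/measurable_EFinP; exact: measurableT_comp.
  - by apply: integral_ge0 => x _; rewrite lee_fin.
split => //.
rewrite {1}/Rintegral -integral12_prod_meas1//.
rewrite (eq_integral (fun x => ((\int[m2]_y g y) * f x)%:E)); last first.
  move=> x _; rewrite /fubini_F/=; under eq_integral do rewrite EFinM.
  rewrite integralZl// /Rintegral mulrC EFinM fineK//.
  exact: integrable_fin_num.
by rewrite -/(Rintegral _ _ _) RintegralZl// mulrC.
Qed.

Lemma Cintegral_tensor (f : T1 -> C) (g : T2 -> C) :
  Cintegrable m1 f -> Cintegrable m2 g ->
  Cintegrable (m1 \x m2)%E (fun z => f z.1 * g z.2) /\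
  Cintegral (m1 \x m2)%E setT (fun z => f z.1 * g z.2) =
  Cintegral m1 setT f * Cintegral m2 setT g.
Proof.
move=> [fr fi] [gr gi].
have [rr rrE] := Rintegral_tensor fr gr.
have [ii iiE] := Rintegral_tensor fi gi.
have [ri riE] := Rintegral_tensor fr gi.
have [ir irE] := Rintegral_tensor fi gr.
split.
  split.
    by under eq_fun do rewrite ReM EFinB; exact: integrableB.
  by under eq_fun do rewrite ImM EFinD; exact: integrableD.
apply: complex_ext.
  by rewrite ReM /= -rrE -iiE -RintegralB//; apply: eq_Rintegral => z _; rewrite ReM.
by rewrite ImM /= -riE -irE -RintegralD//; apply: eq_Rintegral => z _; rewrite ImM.
Qed.

End product.

(** Lebesgue measure in dimension n+1 is by definition the image of a product
measure under [rVcons]; this turns an integral over it into one over the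
product. *)
Lemma integral_rVS n (f : 'rV[R]_n.+1 -> \bar R) : measurable_fun setT f ->
  (leb \x lebesgue_rV R n)%E.-integrable setT (f \o @rVcons R n) ->
  (lebesgue_rV R n.+1).-integrable setT f /\
  (\int[lebesgue_rV R n.+1]_x f x =
   \int[(leb \x lebesgue_rV R n)%E]_z f (rVcons z))%E.
Proof.
move=> mf hf.
have mphi : measurable_fun [set: measurableTypeR R * 'rV[R]_n] (@rVcons R n).
  exact: measurable_rVcons.
have e (g : 'rV[R]_n.+1 -> \bar R) : (\int[lebesgue_rV R n.+1]_x g x =
    \int[pushforward (leb \x lebesgue_rV R n)%E (@rVcons R n)]_x g x)%E.
  exact: eq_measure_integral.
split; last by rewrite e integral_pushforward.
apply/integrableP; split => //.
rewrite e ge0_integral_pushforward//=; last exact: measurableT_comp.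
by have /integrableP[] := hf.
Qed.

Lemma Cintegral_rVS n (f : 'rV[R]_n.+1 -> C) :
  measurable_fun setT (fun x => complex.Re (f x)) ->
  measurable_fun setT (fun x => complex.Im (f x)) ->
  Cintegrable (leb \x lebesgue_rV R n)%E (f \o @rVcons R n) ->
  Cintegrable (lebesgue_rV R n.+1) f /\
  Cintegral (lebesgue_rV R n.+1) setT f =
  Cintegral (leb \x lebesgue_rV R n)%E setT (f \o @rVcons R n).
Proof.
move=> /measurable_EFinP mr /measurable_EFinP mi [ir ii].
have [jr er] := integral_rVS mr ir; have [ji ei] := integral_rVS mi ii.
by split; [split|apply: complex_ext; rewrite /= /Rintegral ?er ?ei].
Qed.

Definition Cmeas d (T : measurableType d) (f : T -> C) :=
  measurable_fun setT (fun x => complex.Re (f x)) /\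
  measurable_fun setT (fun x => complex.Im (f x)).

Lemma Cmeas_prod d (T : measurableType d) (I : Type) (s : seq I) (f : I -> T -> C) :
  (forall i, Cmeas (f i)) -> Cmeas (fun x => \prod_(i <- s) f i x).
Proof.
move=> mf; elim: s => [|i s [IHr IHi]].
  by split; under eq_fun do rewrite big_nil; exact: measurable_cst.
have [mr mi] := mf i; split; under eq_fun do rewrite big_cons ?ReM ?ImM.
  by apply: measurable_funB; apply: measurable_funM.
by apply: measurable_funD; apply: measurable_funM.
Qed.

Lemma Cintegral_prod n (h : 'I_n -> R -> C) :
  (forall i, Cintegrable leb (h i)) ->
  Cintegrable (lebesgue_rV R n) (fun x => \prod_(i < n) h i (x ord0 i)) /\
  Cintegral (lebesgue_rV R n) setT (fun x => \prod_(i < n) h i (x ord0 i)) =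
  \prod_(i < n) Cintegral leb setT (h i).
Proof.
elim: n h => [h _|n IHn h hI].
  rewrite big_ord0 (_ : (fun x => _) = (fun=> 1)); last first.
    by apply/funext => x; rewrite big_ord0.
  have i (c : R) : (lebesgue_rV R 0).-integrable setT (fun=> c%:E).
    by apply: finite_measure_integrable_cst; exact: measurableT.
  split; first by split; exact: i.
  have e (c : R) : \int[lebesgue_rV R 0]_x c = c.
    by rewrite /Rintegral integral_dirac// diracT mul1e.
  by apply: complex_ext; rewrite /= e.
have [I1 I2] := IHn (fun i => h (lift ord0 i)) (fun i => hI _).
have [t1 t2] := Cintegral_tensor (hI ord0) I1.
rewrite big_ord_recl -I2 -t2.
have E : (fun x : 'rV[R]_n.+1 => \prod_(i < n.+1) h i (x ord0 i)) \o @rVcons R n =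
   (fun z => h ord0 z.1 * \prod_(i < n) h (lift ord0 i) (z.2 ord0 i)).
  apply/funext => z /=; rewrite big_ord_recl rVcons0; congr (_ * _).
  by apply: eq_bigr => i _; rewrite rVconsS.
have [mr mi] : Cmeas (fun x : 'rV[R]_n.+1 => \prod_(i < n.+1) h i (x ord0 i)).
  apply: Cmeas_prod => i; have [/integrableP[mr _] /integrableP[mi _]] := hI i.
  move/measurable_EFinP: mr => mr; move/measurable_EFinP: mi => mi.
  split.
    exact: (measurableT_comp mr (@measurable_coord_rV _ _ _ i)).
  exact: (measurableT_comp mi (@measurable_coord_rV _ _ _ i)).
have [J1 J2] := Cintegral_rVS mr mi (eq_ind_r (Cintegrable _) t1 E).
by split => //; rewrite J2 E.
Qed.

End complex_integrals.

(** * Evolution of Gaussians *)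
Section gaussian_evolution.
Context (R : realType).
Local Notation C := (R[i]).
Notation leb := (@lebesgue_measure R).

Lemma cexpiD (s t : R) : cexpi (s + t) = cexpi s * cexpi t.
Proof.
by apply: complex_ext; rewrite ?ReM ?ImM /= ?cosD ?sinD// addrC; congr (_ + _); rewrite mulrC.
Qed.

Lemma cexpi0 : cexpi (0 : R) = 1.
Proof. by rewrite /cexpi cos0 sin0. Qed.

Lemma cexpi_sum (I : Type) (s : seq I) (P : pred I) (f : I -> R) :
  cexpi (\sum_(i <- s | P i) f i) = \prod_(i <- s | P i) cexpi (f i).
Proof. exact: (big_morph _ cexpiD cexpi0). Qed.

(** Change of variables is available for nonnegative integrands; the general case
follows by writing f as the difference of |f| + f and |f|. *)
Lemma integral_shift (c : R) (f : R -> R) : continuous f ->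
  leb.-integrable setT (fun y => (f y)%:E) ->
  leb.-integrable setT (fun y => (f (y - c))%:E) /\
  \int[leb]_y f (y - c) = \int[leb]_y f y.
Proof.
move=> cf fi.
have ge0 (g : R -> R) : continuous g -> (forall y, 0 <= g y) ->
    (\int[leb]_y (g (y - c))%:E = \int[leb]_y (g y)%:E)%E.
  move=> cg g0.
  have dF : (fun y : R => y - c)^`()%classic = cst 1.
    by apply/funext => y; rewrite derive1E; apply: derive_val; derive1; rewrite subr0.
  rewrite (@increasing_ge0_integration_by_substitutionT R (fun y => y - c) g)//.
  - by apply: eq_integral => y _; rewrite dF /= !fctE mulr1.
  - by move=> y z yz; rewrite ltrD2r.
  - by rewrite dF; exact: cst_continuous.
  - by rewrite dF; exact: is_cvg_cst.
  - by rewrite dF; exact: is_cvg_cst.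
  - exact: cvg_addrr_Ny.
  - exact: cvg_addrr.
have cabs : continuous (fun y => `|f y|).
  by move=> y; apply: (continuous_comp (cf y)); exact: norm_continuous.
have csh (g : R -> R) : continuous g -> continuous (fun y => g (y - c)).
  move=> cg y; apply: (continuous_comp (f := fun y => y - c)); last exact: cg.
  by apply: cvgB; [exact: cvg_id|exact: cvg_cst].
have si (g : R -> R) : continuous g -> leb.-integrable setT (fun y => (g y)%:E) ->
    leb.-integrable setT (fun y => (g (y - c))%:E).
  move=> cg /integrableP[mg gi]; apply/integrableP; split.
    by apply/measurable_EFinP; apply: continuous_measurable_fun; exact: csh.
  rewrite (ge0 (fun y => `|g y|))// => y.
  by apply: (continuous_comp (cg y)); exact: norm_continuous.
split; first exact: si.
have ai : leb.-integrable setT (fun y => (`|f y|)%:E) by exact: integrable_norm.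
have pi1 : leb.-integrable setT (fun y => (`|f y| + f y)%:E).
  by under eq_fun do rewrite EFinD; exact: integrableD.
have -> : \int[leb]_y f y = \int[leb]_y (`|f y| + f y) - \int[leb]_y `|f y|.
  by rewrite -RintegralB//; apply: eq_Rintegral => y _; rewrite addrAC subrr add0r.
have -> : \int[leb]_y f (y - c) =
    \int[leb]_y (`|f (y - c)| + f (y - c)) - \int[leb]_y `|f (y - c)|.
  rewrite -RintegralB//.
  - by apply: eq_Rintegral => y _; rewrite addrAC subrr add0r.
  - apply: (si (fun y => `|f y| + f y)) => //.
    by move=> y; apply: cvgD; [exact: cabs|exact: cf].
  - exact: (si (fun y => `|f y|)).
congr (_ - _); congr fine.
  apply: (ge0 (fun y => `|f y| + f y)) => y; last by rewrite -lerBlDr sub0r ler_normr lexx orbT.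
  by apply: cvgD; [exact: cabs|exact: cf].
exact: (ge0 (fun y => `|f y|)).
Qed.

(** [oscillatory_gaussian_integral] in complex form. *)
Lemma Cgaussian_integral (a x tau : R) : 0 < a ->
  let z2 := a ^+ 2 + tau ^+ 2 in
  let m := Num.sqrt (pi / a) * expR (ln (a ^+ 2) / 4 - ln z2 / 4 - a * x ^+ 2 / (4 * z2)) in
  let b := x ^+ 2 * tau / (4 * z2) - atan (tau / a) / 2 in
  Cintegrable leb (fun y => cexpi (x * y - tau * y ^+ 2) * (expR (- a * y ^+ 2))%:C%C) /\
  Cintegral leb setT (fun y => cexpi (x * y - tau * y ^+ 2) * (expR (- a * y ^+ 2))%:C%C) =
  m%:C%C * cexpi b.
Proof.
move=> a0 z2 m b.
have [i1 i2 e1 e2] := oscillatory_gaussian_integral x tau a0.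
have r (t u : R) : complex.Re (cexpi t * u%:C%C) = u * cos t.
  by rewrite ReM /= mulr0 subr0 mulrC.
have s (t u : R) : complex.Im (cexpi t * u%:C%C) = u * sin t.
  by rewrite ImM /= mulr0 add0r mulrC.
split.
  by split; under eq_fun do rewrite ?r ?s.
apply: complex_ext.
  by rewrite [m%:C%C * _]mulrC r -e1; apply: eq_Rintegral => y _; rewrite r.
by rewrite [m%:C%C * _]mulrC s -e2; apply: eq_Rintegral => y _; rewrite s.
Qed.

Lemma fourier_gaussian1 (c xi : R) :
  let f := fun y : R => cexpi (- (y * xi)) * (expR (- (y - c) ^+ 2 / 4))%:C%C in
  Cintegrable leb f /\
  Cintegral leb setT f = cexpi (- (c * xi)) * (Num.sqrt (4 * pi) * expR (- xi ^+ 2))%:C%C.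
Proof.
move=> f.
have q0 : 0 < 4^-1 :> R by rewrite invr_gt0.
have [[ir ii] e] := Cgaussian_integral (- xi) 0 q0.
pose g (y : R) : C := cexpi (- xi * y - 0 * y ^+ 2) * (expR (- 4^-1 * y ^+ 2))%:C%C.
have gi : Cintegrable leb g by [].
have cg : continuous (fun y => complex.Re (g y)) /\ continuous (fun y => complex.Im (g y)).
  split.
    apply: (@is_derive_continuous _ _ (fun y => complex.Re (g y) * (- y / 2) + xi * complex.Im (g y))) => y.
    rewrite (_ : (fun y => _) = (fun y : R => cos (- xi * y - 0 * y ^+ 2) * expR (- 4^-1 * y ^+ 2))).
      by derive1; rewrite ?ReM ?ImM /=; field.
    by apply/funext => z; rewrite ReM /= mulr0 subr0.
  apply: (@is_derive_continuous _ _ (fun y => complex.Im (g y) * (- y / 2) - xi * complex.Re (g y))) => y.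
  rewrite (_ : (fun y => _) = (fun y : R => sin (- xi * y - 0 * y ^+ 2) * expR (- 4^-1 * y ^+ 2))).
    by derive1; rewrite ?ReM ?ImM /=; field.
  by apply/funext => z; rewrite ImM /= mulr0 add0r.
have [jr er] := integral_shift c cg.1 ir.
have [ji ei] := integral_shift c cg.2 ii.
have fE : f = fun y => cexpi (- (c * xi)) * g (y - c).
  by apply/funext => y; rewrite /f /g mulrA -cexpiD; congr (cexpi _ * (expR _)%:C%C); field.
have [k1 k2] := CintegralZ (cexpi (- (c * xi))) (conj jr ji).
rewrite fE; split; first exact: k1.
rewrite k2; congr (_ * _).
transitivity (Cintegral leb setT g).
  by apply: complex_ext; [exact: er|exact: ei].
rewrite e; apply: complex_ext; rewrite ?ReM ?ImM /= !mul0r atan0 !mul0r !mulr0 ?mul0r subrr.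
  rewrite cos0 mulr1 subr0; congr (Num.sqrt _ * expR _).
    by rewrite invrK mulrC.
  by rewrite expr0n addr0 subrr; field.
by rewrite sin0 mulr0 addr0.
Qed.

Definition gauss n (w : 'rV[R]_n) : R := expR (- dot_rV w w / 4).

(** Modulus and argument of (1 + i t)^(-n/2) exp(-|w|^2 / (4 (1 + i t))). *)
Definition gauss_modulus n (t : R) (w : 'rV[R]_n) : R :=
  expR (- (n%:R * ln (1 + t ^+ 2) / 4) - dot_rV w w / (4 * (1 + t ^+ 2))).

Definition gauss_phase n (t : R) (w : 'rV[R]_n) : R :=
  t * dot_rV w w / (4 * (1 + t ^+ 2)) - n%:R * atan t / 2.

Definition gauss_evolution n (t : R) (w : 'rV[R]_n) : C :=
  (gauss_modulus t w)%:C%C * cexpi (gauss_phase t w).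

Lemma gauss_prod n (w : 'rV[R]_n) :
  gauss w = \prod_(i < n) expR (- w ord0 i ^+ 2 / 4).
Proof.
rewrite /gauss /dot_rV -sumrN mulr_suml expR_sum.
by apply: eq_bigr => i _; rewrite expr2.
Qed.

Lemma RtoC_prod (I : Type) (s : seq I) (f : I -> R) :
  ((\prod_(i <- s) f i)%:C = \prod_(i <- s) (f i)%:C)%C.
Proof. exact: rmorph_prod. Qed.

Lemma gauss_evolution_prod n (t : R) (w : 'rV[R]_n) :
  gauss_evolution t w = \prod_(i < n)
    ((expR (- (ln (1 + t ^+ 2) / 4) - w ord0 i ^+ 2 / (4 * (1 + t ^+ 2))))%:C%C *
     cexpi (t * w ord0 i ^+ 2 / (4 * (1 + t ^+ 2)) - atan t / 2)).
Proof.
rewrite big_split/= -RtoC_prod -expR_sum -cexpi_sum; congr ((expR _)%:C%C * cexpi _).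
  rewrite big_split/= sumr_const card_ord !sumrN -mulr_suml /dot_rV.
  congr (_ - _ / _); first by rewrite -[_ *+ n]mulr_natl; ring.
rewrite sumrB sumr_const card_ord -mulr_suml -mulr_sumr /gauss_phase /dot_rV.
by rewrite -[atan t / 2 *+ n]mulr_natl; congr (_ * _ / _ - _); rewrite mulrA.
Qed.

(** One factor of the inverse Fourier transform: the exponent combines to
(x - c) xi - t xi^2, to which [Cgaussian_integral] applies with a = 1. *)
Lemma evolution_gaussian1 (c x t : R) :
  let f := fun xi : R => cexpi (x * xi - t * xi ^+ 2) *
    (cexpi (- (c * xi)) * (Num.sqrt (4 * pi) * expR (- xi ^+ 2))%:C%C) in
  Cintegrable leb f /\
  ((2 * pi)^-1)%:C%C * Cintegral leb setT f =
  (expR (- (ln (1 + t ^+ 2) / 4) - (x - c) ^+ 2 / (4 * (1 + t ^+ 2))))%:C%C *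
     cexpi (t * (x - c) ^+ 2 / (4 * (1 + t ^+ 2)) - atan t / 2).
Proof.
move=> f.
have [i e] := Cgaussian_integral (x - c) t ltr01.
have [i2 e2] := CintegralZ (Num.sqrt (4 * pi))%:C%C i.
have fE : f = fun xi => (Num.sqrt (4 * pi))%:C%C *
    (cexpi ((x - c) * xi - t * xi ^+ 2) * (expR (- 1 * xi ^+ 2))%:C%C).
  apply/funext => xi; rewrite /f.
  have -> : (x - c) * xi - t * xi ^+ 2 = (x * xi - t * xi ^+ 2) + - (c * xi) by ring.
  rewrite (cexpiD (x * xi - _)) mulN1r rmorphM /=.
  by rewrite mulrA [RHS]mulrCA -!mulrA.
rewrite fE; split; first exact: i2.
rewrite e2 e [(Num.sqrt (4 * pi))%:C%C * _]mulrA mulrA -!rmorphM /=; congr ((_)%:C%C * cexpi _); last first.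
  by rewrite expr1n divr1 [t * _]mulrC.
rewrite expr1n ln1 mul0r sub0r mul1r divr1 [4 * pi]mulrC.
have -> : Num.sqrt (pi * 4) = 2 * Num.sqrt pi :> R.
  by rewrite sqrtrM ?pi_ge0// (_ : 4 = 2 ^+ 2) ?sqrtr_sqr ?ger0_norm 1?mulrC// -natrX.
have pn : pi != 0 :> R by rewrite gt_eqF// pi_gt0.
set E := expR _; set s := Num.sqrt pi.
have -> : (2 * pi)^-1 * (2 * s * (s * E)) = (2 * pi)^-1 * (2 * s ^+ 2) * E.
  by rewrite expr2 !mulrA.
by rewrite sqr_sqrtr ?pi_ge0// mulVf ?mul1r// mulf_neq0.
Qed.

(** Both Fourier integrals of a Gaussian are products of one-dimensional ones. *)
Lemma schrodinger_gauss_sum n (t : R) (I : finType) (P : pred I) (c : I -> C)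
    (y : I -> 'rV[R]_n) (x : 'rV[R]_n) :
  schrodinger t (fun z => \sum_(k | P k) c k * (gauss (z - y k))%:C%C) x =
  \sum_(k | P k) c k * gauss_evolution t (x - y k).
Proof.
pose hat (k : I) (xi : 'rV[R]_n) : C := \prod_(i < n)
  (cexpi (- (y k ord0 i * xi ord0 i)) * (Num.sqrt (4 * pi) * expR (- xi ord0 i ^+ 2))%:C%C).
have fourierE xi : fourier (fun z => \sum_(k | P k) c k * (gauss (z - y k))%:C%C) xi =
    \sum_(k | P k) c k * hat k xi.
  rewrite /fourier.
  pose g k (z : 'rV[R]_n) : C := \prod_(i < n)
    (cexpi (- (z ord0 i * xi ord0 i)) * (expR (- (z ord0 i - y k ord0 i) ^+ 2 / 4))%:C%C).
  have gi k : Cintegrable (lebesgue_rV R n) (g k) /\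
      Cintegral (lebesgue_rV R n) setT (g k) = hat k xi.
    pose h i (z : R) := cexpi (- (z * xi ord0 i)) * (expR (- (z - y k ord0 i) ^+ 2 / 4))%:C%C.
    have [i1 i2] := @Cintegral_prod R n h (fun i => (fourier_gaussian1 _ _).1).
    split => //; rewrite i2; apply: eq_bigr => i _; exact: (fourier_gaussian1 _ _).2.
  have [_ ] := @Cintegral_sum _ _ _ (lebesgue_rV R n) I (index_enum I) P c g (fun k _ => (gi k).1).
  under [X in _ = X -> _]eq_bigr do rewrite (gi _).2.
  move=> <-; congr Cintegral; apply/funext => z.
  rewrite mulr_sumr; apply: eq_bigr => k _; rewrite mulrCA; congr (_ * _).
  rewrite /g big_split/= gauss_prod RtoC_prod; congr (_ * _).
    by rewrite /dot_rV -sumrN cexpi_sum.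
  by apply: eq_bigr => i _; rewrite !mxE.
pose g k (xi : 'rV[R]_n) : C := \prod_(i < n)
  (cexpi (x ord0 i * xi ord0 i - t * xi ord0 i ^+ 2) *
   (cexpi (- (y k ord0 i * xi ord0 i)) * (Num.sqrt (4 * pi) * expR (- xi ord0 i ^+ 2))%:C%C)).
pose h k i (xi : R) := cexpi (x ord0 i * xi - t * xi ^+ 2) *
    (cexpi (- (y k ord0 i * xi)) * (Num.sqrt (4 * pi) * expR (- xi ^+ 2))%:C%C).
have gi k : Cintegrable (lebesgue_rV R n) (g k) /\
    Cintegral (lebesgue_rV R n) setT (g k) = \prod_(i < n) Cintegral leb setT (h k i).
  exact: (@Cintegral_prod R n (h k) (fun i => (evolution_gaussian1 _ _ _).1)).
have [_ e] := @Cintegral_sum _ _ _ (lebesgue_rV R n) I (index_enum I) P c g (fun k _ => (gi k).1).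
rewrite /schrodinger.
have -> : (fun xi => cexpi (dot_rV x xi - t * dot_rV xi xi) *
    fourier (fun z => \sum_(k | P k) c k * (gauss (z - y k))%:C%C) xi) =
    (fun xi => \sum_(k | P k) c k * g k xi).
  apply/funext => xi; rewrite fourierE mulr_sumr; apply: eq_bigr => k _.
  rewrite mulrCA; congr (_ * _); rewrite /g big_split/=; congr (_ * _).
  by rewrite -cexpi_sum sumrB -mulr_sumr; congr (cexpi (_ - _ * _)).
rewrite e mulr_sumr; apply: eq_bigr => k _; rewrite mulrCA (gi k).2; congr (_ * _).
have -> : ((2 * pi) ^- n)%:C%C = \prod_(i < n) ((2 * pi)^-1)%:C%C :> C.
  by rewrite prodr_const card_ord -exprVn rmorphXn.
rewrite -big_split/= gauss_evolution_prod; apply: eq_bigr => i _.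
by rewrite (evolution_gaussian1 _ _ _).2 !mxE.
Qed.

End gaussian_evolution.

(** * Schwartz functions from Gaussians and smooth cutoffs *)
Section smooth_cutoff.
Context (R : realType).

Lemma is_derive_line (V : normedModType R) (f : V -> R) (z v : V) (df : R) :
  is_derive z v f df <-> is_derive (0 : R) (1 : R) (fun h : R => f (h *: v + z)) df.
Proof.
have E : (fun h : R => h^-1 *: (f (h *: v + z) - f z)) =
    (fun h : R => h^-1 *: (f ((h *: (1 : R) + 0) *: v + z) - f (0 *: v + z))).
  by apply/funext => h; rewrite addr0 scale0r add0r /GRing.scale/= mulr1.
by split=> -[h1 h2]; (apply: DeriveDef; first by rewrite /derivable ?E// -?E);
  rewrite -h2 /derive ?E.
Qed.

Lemma is_derive_chain (V : normedModType R) (f : V -> R) (g : R -> R)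
    (z v : V) (df dg : R) : is_derive z v f df -> is_derive (f z) (1 : R) g dg ->
  is_derive z v (fun y => g (f y)) (dg * df).
Proof.
move=> /is_derive_line hf hg; apply/is_derive_line.
apply: (@is_derive1_comp _ g (fun h : R => f (h *: v + z))) => //.
by rewrite scale0r add0r.
Qed.

Lemma pow_expRN_bound (k : nat) (u : R) : 0 <= u -> u ^+ k * expR (- u) <= k%:R ^+ k.
Proof.
move=> u0; case: k => [|k]; first by rewrite !expr0 mul1r -expR0 ler_expR oppr_le0.
rewrite expRN ler_pdivrMr ?expR_gt0//.
have -> : expR u = expR (u / k.+1%:R) ^+ k.+1.
  by rewrite -expRM_natl mulrCA mulfV ?mulr1// pnatr_eq0.
rewrite -exprMn lerXn2r ?nnegrE ?mulr_ge0 ?expR_ge0//.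
rewrite -ler_pdivrMl ?ltr0n// mulrC (le_trans _ (expR_ge1Dx _))//.
by rewrite lerDr.
Qed.

(** The powers make the family closed under differentiation, see
[is_derive_flat]; [flat 0] is the usual smooth function that vanishes exactly on
the nonpositive reals. *)
Definition flat (k : nat) (x : R) : R :=
  if 0 < x then x ^- k * expR (- x^-1) else 0.

Lemma flat_ge0 k x : 0 <= flat k x.
Proof.
rewrite /flat; case: ifPn => // x0.
by rewrite mulr_ge0 ?expR_ge0// invr_ge0 exprn_ge0// ltW.
Qed.

Lemma flat_le k x : flat k x <= k%:R ^+ k.
Proof.
rewrite /flat; case: ifPn => [x0|_]; last by rewrite exprn_ge0.
by rewrite -exprVn pow_expRN_bound// invr_ge0 ltW.
Qed.

Lemma flatS k x : flat k x = x * flat k.+1 x.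
Proof.
rewrite /flat; case: ifPn => [x0|_]; last by rewrite mulr0.
by rewrite mulrA exprS invfM mulVKf ?gt_eqF.
Qed.

Lemma flat_le0 k x : x <= 0 -> flat k x = 0.
Proof. by move=> x0; rewrite /flat ltNge x0. Qed.

Lemma is_derive_flat k (x : R) :
  is_derive x (1 : R) (flat k) (flat k.+2 x - k%:R * flat k.+1 x).
Proof.
have [x0|x0|->] := ltgtP x 0.
- rewrite !flat_le0 ?ltW// mulr0 subr0.
  apply: (@near_eq_is_derive _ _ _ (cst (0 : R))).
  near=> y; rewrite flat_le0//; apply/ltW; near: y.
  exact: lt_nbhsl.
- apply: (@near_eq_is_derive _ _ _ (fun y : R => y^-1 ^+ k * expR (- y^-1))).
    near=> y; rewrite /flat exprVn ifT//; near: y; exact: lt_nbhsr.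
  have xn0 : x != 0 by rewrite gt_eqF.
  have h : is_derive x (1 : R) (fun y : R => y^-1) (- x ^- 2).
    have := @is_deriveV R id x 1 1 xn0 (is_derive_id _ _).
    by rewrite /GRing.scale/= mulr1.
  have dG : is_derive x^-1 (1 : R) (fun u : R => u ^+ k * expR (- u))
      (k%:R * x^-1 ^+ k.-1 * expR (- x^-1) - x^-1 ^+ k * expR (- x^-1)).
    case: k => [|k].
      rewrite (_ : (fun u => _) = (fun u : R => expR (- u))); last first.
        by apply/funext => u; rewrite expr0 mul1r.
      by derive1; rewrite expr0; ring.
    have hX := @is_deriveX _ _ id k.+1 x^-1 1 1 (is_derive_id _ _).
    have hX' : is_derive x^-1 (1 : R) (fun u : R => u ^+ k.+1) (k.+1%:R * x^-1 ^+ k).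
      rewrite (_ : (fun u => _) = id ^+ k.+1); last first.
        by apply/funext => u; elim: (k) => [|m IHm]; rewrite ?expr1// exprS IHm [in RHS]exprS.
      by apply: is_derive_eq; rewrite /GRing.scale/= mulr1.
    by derive1; ring.
  refine (@is_derive_eq _ _ _ _ _ _ _ _ (is_derive_chain h dG) _).
  rewrite /flat x0 -!exprVn; move: (x^-1) (expR _) => u w.
  case: k {dG} => [|k] /=; first by rewrite !expr0; ring.
  by rewrite !exprS; ring.
- rewrite !flat_le0// mulr0 subr0.
  have H : h^-1 *: (flat k (h *: (1 : R) + 0) - flat k 0) @[h --> 0^'] --> (0 : R).
    apply: norm_cvg0.
    apply: (@squeeze_cvgr _ _ _ _ (cst 0) (fun h : R => `|h| * (k.+2)%:R ^+ k.+2)).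
    + near=> h; rewrite normr_ge0/=.
      have h0 : h != 0 by near: h; exact: nbhs_dnbhs_neq.
      rewrite [flat k 0]flat_le0// subr0 addr0 /GRing.scale/= mulr1 flatS mulKf//.
      by rewrite flatS normrM ler_wpM2l// ger0_norm ?flat_ge0// flat_le.
    + exact: cvg_cst.
    + rewrite -[X in _ --> X](mul0r ((k.+2)%:R ^+ k.+2)); apply: cvgM; last exact: cvg_cst.
      rewrite -[X in _ --> X](@normr0 _ R); apply: cvg_norm; exact: cvg_within.
  by apply: DeriveDef; [apply/cvg_ex; exists 0|apply/cvg_lim].
Unshelve. all: end_near. Qed.

End smooth_cutoff.

Section schwartz_packets.
Context (R : realType) (n : nat).
Notation V := ('rV[R]_n * R)%type.

(** A class that is closed under directional derivatives ([tame_derive]), contains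
the exponents of Gaussians, and whose members grow at most polynomially in space,
uniformly in time ([tame_bound]).  All derivatives of a Gaussian times a member
of the class are then again of this form. *)
Inductive tame : (V -> R) -> Prop :=
| tame_cst c : tame (fun=> c)
| tame_coord i : tame (fun z => z.1 ord0 i)
| tame_flat k a c : tame (fun z => flat k (a * z.2 + c))
| tame_cos a c : tame (fun z => cos (a * z.2 + c))
| tame_sin a c : tame (fun z => sin (a * z.2 + c))
| tame_add f g : tame f -> tame g -> tame (fun z => f z + g z)
| tame_mul f g : tame f -> tame g -> tame (fun z => f z * g z).

Lemma is_derive_linform (l : V -> R) (z v : V) :
  (forall h w u, l (h *: w + u) = h * l w + l u) -> is_derive z v l (l v).
Proof.
move=> ll; apply/is_derive_line.
rewrite (_ : (fun h => _) = (fun h : R => h * l v + l z)); last by apply/funext => h; rewrite ll.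
by derive1; ring.
Qed.

Lemma is_derive_coord i (z v : V) : is_derive z v (fun z : V => z.1 ord0 i) (v.1 ord0 i).
Proof. by apply: is_derive_linform => h w u; rewrite /= !mxE. Qed.

Lemma is_derive_time (z v : V) : is_derive z v (fun z : V => z.2) v.2.
Proof. by apply: is_derive_linform. Qed.

Lemma is_derive_affine_time a c (z v : V) :
  is_derive z v (fun z : V => a * z.2 + c) (a * v.2).
Proof.
have dg : is_derive z.2 (1 : R) (fun t => a * t + c) a by derive1; ring.
exact: (is_derive_chain (is_derive_time z v) dg).
Qed.

Lemma is_derive_addV (f g : V -> R) (z v : V) df dg : is_derive z v f df ->
  is_derive z v g dg -> is_derive z v (fun z => f z + g z) (df + dg).
Proof. by move=> hf hg; exact: (@is_deriveD _ _ _ f g). Qed.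

Lemma is_derive_mulV (f g : V -> R) (z v : V) df dg : is_derive z v f df ->
  is_derive z v g dg -> is_derive z v (fun z => f z * g z) (f z * dg + g z * df).
Proof. by move=> hf hg; exact: (@is_deriveM _ _ f g). Qed.

Lemma tame_derive f : tame f -> forall v, exists2 df, tame df &
  forall z, is_derive z v f (df z).
Proof.
elim=> {f} [c|i|k a c|a c|a c|f g _ IHf _ IHg|f g tf IHf tg IHg] v.
- by exists (fun=> 0) => [|z]; [exact: tame_cst|exact: is_derive_cst].
- by exists (fun=> v.1 ord0 i) => [|z]; [exact: tame_cst|exact: is_derive_coord].
- exists (fun z => (flat k.+2 (a * z.2 + c) + - k%:R * flat k.+1 (a * z.2 + c)) * (a * v.2)).
    apply: tame_mul (tame_cst _); apply: tame_add (tame_flat _ _ _) _.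
    exact: tame_mul (tame_cst _) (tame_flat _ _ _).
  move=> z; rewrite mulNr.
  exact: (is_derive_chain (is_derive_affine_time a c z v) (is_derive_flat k _)).
- exists (fun z => (-1 * sin (a * z.2 + c)) * (a * v.2)).
    by apply: tame_mul (tame_cst _); exact: tame_mul (tame_cst _) (tame_sin _ _).
  move=> z; rewrite mulN1r.
  exact: (is_derive_chain (is_derive_affine_time a c z v) (is_derive_cos _)).
- exists (fun z => cos (a * z.2 + c) * (a * v.2)).
    by apply: tame_mul (tame_cst _); exact: tame_cos.
  move=> z.
  exact: (is_derive_chain (is_derive_affine_time a c z v) (is_derive_sin _)).
- have [df tdf hf] := IHf v; have [dg tdg hg] := IHg v.
  by exists (fun z => df z + dg z) => [|z]; [exact: tame_add|exact: is_derive_addV].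
- have [df tdf hf] := IHf v; have [dg tdg hg] := IHg v.
  exists (fun z => f z * dg z + g z * df z) => [|z]; last exact: is_derive_mulV.
  by apply: tame_add; exact: tame_mul.
Qed.

Lemma continuous_flat k : continuous (@flat R k).
Proof. exact: is_derive_continuous (@is_derive_flat R k). Qed.

Let continuous_time : continuous (fun z : V => z.2).
Proof. by move=> z; exact: cvg_snd. Qed.

Let continuous_coordV i : continuous (fun z : V => z.1 ord0 i).
Proof.
move=> z; apply: (@continuous_comp _ _ _ (fst : V -> _) (fun y : 'rV[R]_n => y ord0 i)).
  exact: cvg_fst.
exact: coord_continuous.
Qed.

Let continuous_affine a c : continuous (fun z : V => a * z.2 + c).
Proof.
move=> z; apply: cvgD; last exact: cvg_cst.
by apply: cvgM; [exact: cvg_cst|exact: continuous_time].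
Qed.

Lemma tame_continuous f : tame f -> continuous f.
Proof.
elim=> {f} [c|i|k a c|a c|a c|f g _ cf _ cg|f g _ cf _ cg] z.
- exact: cvg_cst.
- exact: continuous_coordV.
- exact: (continuous_comp (@continuous_affine a c z) (@continuous_flat k _)).
- exact: (continuous_comp (@continuous_affine a c z) (@continuous_cos R _)).
- exact: (continuous_comp (@continuous_affine a c z) (@continuous_sin R _)).
- by apply: cvgD; [exact: cf|exact: cg].
- by apply: cvgM; [exact: cf|exact: cg].
Qed.

Lemma coord_le_norm (y : 'rV[R]_n) i : `|y ord0 i| <= `|y|.
Proof.
rewrite {2}/Num.norm/= mx_normrE.
exact: (le_bigmax_cond _ (fun ij : 'I_1 * 'I_n => `|y ij.1 ij.2|) (j := (ord0, i))).
Qed.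

Lemma norm_le_dot (y : 'rV[R]_n) : `|y| ^+ 2 <= dot_rV y y.
Proof.
have d0 : 0 <= dot_rV y y by apply: sumr_ge0 => i _; rewrite -expr2 sqr_ge0.
rewrite -(@sqr_sqrtr _ (dot_rV y y))// lerXn2r ?nnegrE ?sqrtr_ge0//.
rewrite {1}/Num.norm/= mx_normrE; apply: bigmax_le; first exact: sqrtr_ge0.
move=> [i j] _ /=; rewrite -sqrtr_sqr ler_sqrt// /dot_rV (bigD1 j)//= ord1 expr2 lerDl.
by apply: sumr_ge0 => k _; rewrite -expr2 sqr_ge0.
Qed.

Lemma tame_bound f : tame f ->
  exists C m, 0 <= C /\ forall z, `|f z| <= C * (1 + `|z.1|) ^+ m.
Proof.
have one_le (z : V) : 1 <= 1 + `|z.1| by rewrite lerDl.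
have pos (z : V) : 0 <= 1 + `|z.1| by rewrite (le_trans ler01).
elim=> {f} [c|i|k a c|a c|a c|f g _ [C [m [C0 fC]]] _ [D [p [D0 gD]]]|
  f g _ [C [m [C0 fC]]] _ [D [p [D0 gD]]]].
- by exists `|c|, 0%N; split => // z; rewrite expr0 mulr1.
- exists 1, 1%N; split => // z; rewrite mul1r expr1 (le_trans (coord_le_norm _ _))//.
  by rewrite lerDr.
- exists (k%:R ^+ k), 0%N; split => [|z]; first exact: exprn_ge0.
  by rewrite expr0 mulr1 ger0_norm ?flat_ge0// flat_le.
- by exists 1, 0%N; split => // z; rewrite mul1r expr0 cos_max.
- by exists 1, 0%N; split => // z; rewrite mul1r expr0 sin_max.
- exists (C + D), (m + p)%N; split => [|z]; first exact: addr_ge0.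
  rewrite (le_trans (ler_normD _ _))// mulrDl lerD//.
    by rewrite (le_trans (fC z))// ler_wpM2l// ler_weXn2l// leq_addr.
  by rewrite (le_trans (gD z))// ler_wpM2l// ler_weXn2l// leq_addl.
- exists (C * D), (m + p)%N; split => [|z]; first exact: mulr_ge0.
  by rewrite normrM exprD mulrACA ler_pM.
Qed.

Lemma tame_sum (I : Type) (s : seq I) (f : I -> V -> R) :
  (forall i, tame (f i)) -> tame (fun z => \sum_(i <- s) f i z).
Proof.
move=> tf; elim: s => [|i s IH].
  by rewrite (_ : (fun z => _) = (fun=> 0)); [exact: tame_cst|apply/funext => z; rewrite big_nil].
rewrite (_ : (fun z => _) = (fun z => f i z + \sum_(j <- s) f j z)); first exact: tame_add.
by apply/funext => z; rewrite big_cons.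
Qed.

Variable y0 : 'rV[R]_n.

Let W (z : V) := gauss (z.1 - y0).

Let tame_exponent : tame (fun z => - dot_rV (z.1 - y0) (z.1 - y0) / 4).
Proof.
rewrite (_ : (fun z => _) = (fun z : V => (- 4^-1) *
    \sum_i (z.1 ord0 i + - y0 ord0 i) * (z.1 ord0 i + - y0 ord0 i))); last first.
  apply/funext => z; rewrite mulrC mulNr mulrN; congr (- (_ * _)).
  by apply: eq_bigr => i _; rewrite !mxE.
apply: tame_mul (tame_cst _) _; apply: tame_sum => i.
by apply: tame_mul; apply: tame_add (tame_coord _) (tame_cst _).
Qed.

Let derive_W v : exists2 q, tame q & forall z, is_derive z v W (W z * q z).
Proof.
have [q tq dq] := tame_derive tame_exponent v.
by exists q => // z; exact: (is_derive_chain (dq z) (is_derive_expR _)).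
Qed.

Let continuous_W : continuous W.
Proof. by move=> z; exact: (continuous_comp (tame_continuous tame_exponent (x := z)) (@continuous_expR R _)). Qed.

Let derive_packet f : tame f -> forall v, exists2 g, tame g &
  forall z, is_derive z v (fun z => W z * f z) (W z * g z).
Proof.
move=> tf v; have [df tdf hf] := tame_derive tf v; have [q tq hq] := derive_W v.
exists (fun z => df z + f z * q z); first by apply: tame_add => //; exact: tame_mul.
move=> z; have := is_derive_mulV (hq z) (hf z).
by rewrite mulrDr [f z * (W z * _)]mulrCA.
Qed.

Let iter_derive_packet f : tame f -> forall vs, exists2 g, tame g &
  iter_derive vs (fun z => W z * f z) = (fun z => W z * g z).
Proof.
move=> tf; elim => [|v vs [g tg IH]]; first by exists f.
have [h th hd] := derive_packet tg v.
exists h => //; rewrite /= -/(iter_derive vs _) IH.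
by apply/funext => z; exact: (@derive_val _ _ _ _ _ _ _ (hd z)).
Qed.

Let iter_derive_vanish (f : V -> R) (U : set V) : open U ->
  (forall z, U z -> f z = 0) -> forall vs z, U z -> iter_derive vs f z = 0.
Proof.
move=> oU f0; elim => [//|v vs IH] z Uz /=.
have : is_derive z v (iter_derive vs f) 0.
  apply: (@near_eq_is_derive _ _ _ (cst 0)).
  by have := open_nbhs_nbhs (conj oU Uz); apply: filterS => y Uy; rewrite IH.
by move=> h; exact: (@derive_val _ _ _ _ _ _ _ h).
Qed.

(** The Gaussian absorbs the polynomial growth in space, and the support condition
handles time. *)
Lemma schwartz_packet f (T0 T1 : R) : tame f ->
  (forall z, z.2 < T0 -> f z = 0) -> (forall z, T1 < z.2 -> f z = 0) ->
  schwartz_real (fun z : V => gauss (z.1 - y0) * f z).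
Proof.
move=> tf f0 f1; split.
  move=> vs; have [g tg ->] := iter_derive_packet tf vs.
  split.
    by move=> z; apply: cvgM; [exact: continuous_W|exact: tame_continuous].
  by move=> v z; have [h _ hd] := derive_packet tg v; have [] := hd z.
move=> k vs; have [g tg gE] := iter_derive_packet tf vs.
have [C [m [C0 gC]]] := tame_bound tg.
pose T := Num.max `|T0| `|T1|.
have T_ge0 : 0 <= T by rewrite le_max normr_ge0.
pose M := C * (1 + T) ^+ k * (1 + `|y0|) ^+ (m + k) * (expR 2 * (m + k)%:R ^+ (m + k)).
have M0 : 0 <= M by rewrite /M !mulr_ge0 ?exprn_ge0 ?expR_ge0 ?addr_ge0.
have openT (D : set R) : open D -> open ((fun z : V => z.2) @^-1` D).
  by move: D; apply/continuousP; exact: continuous_time.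
exists M => z.
have [z0|z0] := ltP z.2 T0.
  rewrite (@iter_derive_vanish _ [set z : V | z.2 < T0])//.
  - by rewrite normr0 mulr0.
  - exact: (openT _ (@open_lt R T0)).
  - by move=> y yT; rewrite f0// mulr0.
have [z1|z1] := ltP T1 z.2.
  rewrite (@iter_derive_vanish _ [set z : V | T1 < z.2])//.
  - by rewrite normr0 mulr0.
  - exact: (openT _ (@open_gt R T1)).
  - by move=> y yT; rewrite f1// mulr0.
rewrite gE normrM ger0_norm ?expR_ge0//.
have zT : `|z| <= (1 + T) * (1 + `|z.1|).
  have z2 : `|z.2| <= T.
    rewrite ler_norml; apply/andP; split.
      by rewrite (le_trans _ z0)// lerNl (le_trans (ler_norm _))// normrN le_max lexx.
    by rewrite (le_trans z1)// (le_trans (ler_norm _))// le_max lexx orbT.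
  rewrite prod_normE ge_max; apply/andP; split; have := normr_ge0 z.1; nra.
set w := `|z.1 - y0|; have w0 : 0 <= w by exact: normr_ge0.
have zw : 1 + `|z.1| <= (1 + `|y0|) * (1 + w).
  have : `|z.1| <= w + `|y0| by rewrite -{1}(subrK y0 z.1) ler_normD.
  have := normr_ge0 y0; have : 0 <= w by exact: normr_ge0.
  nra.
have Ww : W z <= expR 2 * expR (- (1 + w)).
  rewrite /W /gauss -expRD ler_expR.
  have := norm_le_dot (z.1 - y0); rewrite -/w => h.
  have := sqr_ge0 (w - 2); rewrite mulNr; nra.
apply: (@le_trans _ _ ((1 + T) ^+ k * (1 + `|z.1|) ^+ k *
    (expR 2 * expR (- (1 + w)) * (C * (1 + `|z.1|) ^+ m)))).
  apply: ler_pM; rewrite ?mulr_ge0 ?exprn_ge0 ?expR_ge0//.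
    by rewrite -exprMn lerXn2r ?nnegrE ?mulr_ge0 ?addr_ge0.
  by apply: ler_pM => //; exact: expR_ge0.
have -> : (1 + T) ^+ k * (1 + `|z.1|) ^+ k *
    (expR 2 * expR (- (1 + w)) * (C * (1 + `|z.1|) ^+ m)) =
    C * (1 + T) ^+ k * expR 2 * ((1 + `|z.1|) ^+ (m + k) * expR (- (1 + w))).
  by rewrite exprD; ring.
have -> : M = C * (1 + T) ^+ k * expR 2 * ((1 + `|y0|) ^+ (m + k) * (m + k)%:R ^+ (m + k)).
  by rewrite /M; ring.
rewrite ler_wpM2l ?mulr_ge0 ?exprn_ge0 ?expR_ge0 ?addr_ge0//.
apply: (@le_trans _ _ ((1 + `|y0|) ^+ (m + k) * ((1 + w) ^+ (m + k) * expR (- (1 + w))))).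
  rewrite mulrA ler_wpM2r ?expR_ge0// -exprMn.
  by rewrite lerXn2r ?nnegrE ?mulr_ge0 ?addr_ge0//.
rewrite ler_wpM2l ?exprn_ge0 ?addr_ge0// pow_expRN_bound// addr_ge0//.
Qed.

End schwartz_packets.

Section schwartz_sums.
Context (R : realType) (V : normedModType R).

Lemma iter_deriveD (f g : V -> R) vs : smooth f -> smooth g ->
  iter_derive vs (fun z => f z + g z) = (fun z => iter_derive vs f z + iter_derive vs g z).
Proof.
move=> sf sg; elim: vs => [//|v vs IH] /=.
rewrite -/(iter_derive vs (fun z => f z + g z)) IH; apply/funext => z.
have [_ df] := sf vs; have [_ dg] := sg vs.
exact: (@deriveD _ _ _ (iter_derive vs f) (iter_derive vs g)).
Qed.

Lemma schwartz_realD (f g : V -> R) : schwartz_real f -> schwartz_real g ->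
  schwartz_real (fun z => f z + g z).
Proof.
move=> [sf bf] [sg bg]; split.
  move=> vs; rewrite iter_deriveD//; have [cf df] := sf vs; have [cg dg] := sg vs.
  split; first by move=> z; apply: cvgD; [exact: cf|exact: cg].
  by move=> v z; exact: (@derivableD _ _ _ (iter_derive vs f) (iter_derive vs g)).
move=> k vs; have [M hM] := bf k vs; have [N hN] := bg k vs.
exists (M + N) => z; rewrite iter_deriveD//.
by rewrite (le_trans _ (lerD (hM z) (hN z)))// -mulrDr ler_wpM2l// ler_normD.
Qed.

Lemma schwartz_real0 : @schwartz_real R V (fun=> 0).
Proof.
have E vs : @iter_derive R V vs (fun=> 0) = (fun=> 0).
  elim: vs => [//|v vs /= IH]; rewrite -/(iter_derive vs _) IH.
  by apply/funext => z; exact: derive_cst.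
split.
  by move=> vs; rewrite E; split; [exact: cst_continuous|move=> v x; exact: derivable_cst].
by move=> k vs; exists 0 => x; rewrite E normr0 mulr0.
Qed.

Lemma schwartz_real_sum (I : Type) (s : seq I) (P : pred I) (f : I -> V -> R) :
  (forall k, P k -> schwartz_real (f k)) -> schwartz_real (fun z => \sum_(k <- s | P k) f k z).
Proof.
move=> sf; elim: s => [|k s IH].
  rewrite (_ : (fun z => _) = (fun=> 0)); first exact: schwartz_real0.
  by apply/funext => z; rewrite big_nil.
case: (boolP (P k)) => Pk.
  rewrite (_ : (fun z => _) = (fun z => f k z + \sum_(j <- s | P j) f j z)).
    by apply: schwartz_realD => //; exact: sf.
  by apply/funext => z; rewrite big_cons Pk.
rewrite (_ : (fun z => _) = (fun z => \sum_(j <- s | P j) f j z))//.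
by apply/funext => z; rewrite big_cons (negbTE Pk).
Qed.

End schwartz_sums.

(** * The source and its norm *)
Section source.
Context (R : realType).
Local Notation C := (R[i]).

Definition bump (u : R) : R := flat 0 u * flat 0 (1 - u).

Lemma bump_ge0 u : 0 <= bump u.
Proof. by rewrite mulr_ge0 ?flat_ge0. Qed.

Lemma bump_le1 u : bump u <= 1.
Proof. by rewrite -[1]mulr1 ler_pM ?flat_ge0// (le_trans (flat_le 0 _)). Qed.

Lemma bump_out u : ~~ (0 < u < 1) -> bump u = 0.
Proof.
rewrite negb_and -!leNgt /bump => /orP[u0|u1]; first by rewrite flat_le0// mul0r.
by rewrite [flat 0 (1 - u)]flat_le0 ?mulr0// subr_le0.
Qed.

Lemma bump_in u : 1 / 4 <= u <= 3 / 4 -> expR (- 8) <= bump u.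
Proof.
move=> /andP[u0 u1].
have h (v : R) : 1 / 4 <= v -> expR (- 4) <= flat 0 v.
  move=> v4; have v0 : 0 < v by lra.
  rewrite /flat v0 expr0 invr1 mul1r ler_expR lerN2.
  by rewrite -[leRHS]invrK lef_pV2 ?posrE//; lra.
have -> : - 8 = - 4 + - 4 :> R by lra.
by rewrite expRD ler_pM ?expR_ge0 ?h//; lra.
Qed.

Lemma continuous_bump : continuous bump.
Proof.
move=> u; apply: cvgM; first exact: continuous_flat.
apply: (@continuous_comp _ _ _ (fun u : R => 1 - u) (@flat R 0)); last exact: continuous_flat.
by apply: cvgB; [exact: cvg_cst|exact: cvg_id].
Qed.

Context (n : nat) (I : finType) (P : pred I) (y : I -> 'rV[R]_n) (b : I -> R) (M S0 : R).
Hypothesis M0 : 0 < M.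

Definition start k := S0 - b k.

Definition profile k (s : R) := bump ((s - start k) / M).

(** The frequency 1/4 in time is, to leading order, that of the evolved Gaussian
near tau = |w|; the
constant phase compensates for the starting time. *)
Definition amplitude k (s : R) : C :=
  cexpi (- (s / 4) - b k / 2) * (profile k s)%:C%C.

Definition source (z : 'rV[R]_n * R) : C :=
  \sum_(k | P k) amplitude k z.2 * (gauss (z.1 - y k))%:C%C.

Lemma Re_sum (J : Type) (s : seq J) (Q : pred J) (f : J -> C) :
  complex.Re (\sum_(k <- s | Q k) f k) = \sum_(k <- s | Q k) complex.Re (f k).
Proof. exact: (big_morph _ (@ReD R) erefl). Qed.

Lemma Im_sum (J : Type) (s : seq J) (Q : pred J) (f : J -> C) :
  complex.Im (\sum_(k <- s | Q k) f k) = \sum_(k <- s | Q k) complex.Im (f k).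
Proof. exact: (big_morph _ (@ImD R) erefl). Qed.

Lemma ReMr (z : C) (u : R) : complex.Re (z * u%:C%C) = complex.Re z * u.
Proof. by rewrite ReM /= mulr0 subr0. Qed.

Lemma ImMr (z : C) (u : R) : complex.Im (z * u%:C%C) = complex.Im z * u.
Proof. by rewrite ImM /= mulr0 add0r. Qed.

Lemma profile_out k s : ~~ (start k < s < start k + M) -> profile k s = 0.
Proof.
move=> h; apply: bump_out; apply: contra h.
move=> /andP[u0 u1]; apply/andP; split.
  by move: u0; rewrite pmulr_lgt0 ?invr_gt0// subr_gt0.
by move: u1; rewrite ltr_pdivrMr// mul1r ltrBlDl.
Qed.

Lemma schwartz_source : schwartz source.
Proof.
have supp k z : (z < start k \/ start k + M < z) ->
    flat 0 (M^-1 * z + - start k / M) * flat 0 (- M^-1 * z + (1 + start k / M)) = 0.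
  move=> h; have := @profile_out k z; rewrite /profile /bump.
  have -> : (z - start k) / M = M^-1 * z + - start k / M by ring.
  have -> : 1 - (M^-1 * z + - start k / M) = - M^-1 * z + (1 + start k / M) by ring.
  apply; rewrite negb_and -!leNgt; case: h => /ltW -> //; exact: orbT.
have tf k : tame (n := n) (fun z => flat 0 (M^-1 * z.2 + - start k / M) * flat 0 (- M^-1 * z.2 + (1 + start k / M))).
  by apply: tame_mul; exact: tame_flat.
have E k s : profile k s = flat 0 (M^-1 * s + - start k / M) * flat 0 (- M^-1 * s + (1 + start k / M)).
  by rewrite /profile /bump; congr (flat 0 _ * flat 0 _); ring.
split.
  rewrite (_ : (fun x => _) = (fun z => \sum_(k | P k) gauss (z.1 - y k) *
    (cos (- 4^-1 * z.2 + - b k / 2) * (flat 0 (M^-1 * z.2 + - start k / M) *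
       flat 0 (- M^-1 * z.2 + (1 + start k / M)))))); last first.
    apply/funext => z; rewrite Re_sum; apply: eq_bigr => k _.
    rewrite !ReMr mulrC E; congr (_ * (_ * _)).
    by rewrite /=; congr cos; ring.
  apply: schwartz_real_sum => k _.
  apply: (@schwartz_packet _ _ _ _ (start k) (start k + M)).
  - by apply: tame_mul; [exact: tame_cos|exact: tf].
  - by move=> z zk; rewrite supp ?mulr0//; left.
  - by move=> z zk; rewrite supp ?mulr0//; right.
rewrite (_ : (fun x => _) = (fun z => \sum_(k | P k) gauss (z.1 - y k) *
    (sin (- 4^-1 * z.2 + - b k / 2) * (flat 0 (M^-1 * z.2 + - start k / M) *
       flat 0 (- M^-1 * z.2 + (1 + start k / M)))))); last first.
  apply/funext => z; rewrite Im_sum; apply: eq_bigr => k _.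
  rewrite !ImMr mulrC E; congr (_ * (_ * _)).
  by rewrite /=; congr sin; ring.
apply: schwartz_real_sum => k _.
apply: (@schwartz_packet _ _ _ _ (start k) (start k + M)).
- by apply: tame_mul; [exact: tame_sin|exact: tf].
- by move=> z zk; rewrite supp ?mulr0//; left.
- by move=> z zk; rewrite supp ?mulr0//; right.
Qed.

End source.

Section source_norm.
Context (R : realType).
Local Notation C := (R[i]).
Notation leb := (@lebesgue_measure R).

Lemma integral_gauss n (y : 'rV[R]_n) :
  (lebesgue_rV R n).-integrable setT (fun z => (gauss (z - y))%:E) /\
  \int[lebesgue_rV R n]_z gauss (z - y) = Num.sqrt (4 * pi) ^+ n.
Proof.
have q0 : 0 < 4^-1 :> R by rewrite invr_gt0.
pose h (i : 'I_n) (t : R) : C := (expR (- 4^-1 * (t - y ord0 i) ^+ 2))%:C%C.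
have hi i : Cintegrable leb (h i) /\ Cintegral leb setT (h i) = (Num.sqrt (4 * pi))%:C%C.
  have [i1 e1] := integral_gaussian q0 (y ord0 i).
  split; first by split => //; exact: integrable0.
  apply: complex_ext; rewrite /=; last by rewrite /Rintegral integral0.
  by rewrite e1 invrK mulrC.
have [[i1 _] i2] := @Cintegral_prod R n h (fun i => (hi i).1).
have E z : gauss (z - y) = complex.Re (\prod_(i < n) h i (z ord0 i)).
  rewrite gauss_prod /h -RtoC_prod /=; apply: eq_bigr => i _; rewrite !mxE.
  by congr expR; rewrite mulrC mulrN mulNr.
split; first by under eq_fun do rewrite E.
under eq_Rintegral do rewrite E.
have := congr1 (@complex.Re R) i2; rewrite /= => ->.
under eq_bigr do rewrite (hi _).2.
by rewrite prodr_const card_ord -rmorphXn.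
Qed.

Lemma gauss_ge0 n (w : 'rV[R]_n) : 0 <= gauss w. Proof. exact: expR_ge0. Qed.

Lemma normc_ge0 (z : C) : 0 <= Normc.normc z.
Proof. by case: z => u v; exact: sqrtr_ge0. Qed.

Lemma normc_sum (J : Type) (s : seq J) (Q : pred J) (f : J -> C) :
  Normc.normc (\sum_(k <- s | Q k) f k) <= \sum_(k <- s | Q k) Normc.normc (f k).
Proof.
elim/big_ind2: _ => [|z u w v zu wv|//]; first by rewrite Normc.normc0.
exact: le_trans (le_normcD _ _) (lerD zu wv).
Qed.

Lemma normc_cexpi (t : R) : Normc.normc (cexpi t) = 1.
Proof. by rewrite /Normc.normc /= cos2Dsin2 sqrtr1. Qed.

Lemma normc_real (u : R) : Normc.normc (u%:C)%C = `|u|.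
Proof. by rewrite /Normc.normc /= expr0n addr0 sqrtr_sqr. Qed.

Context (n : nat) (I : finType) (P : pred I) (y : I -> 'rV[R]_n) (b : I -> R) (M S0 : R).
Hypothesis M0 : 0 < M.

Let measurable_sumP d (T : measurableType d) (f : I -> T -> R) :
  (forall k, measurable_fun setT (f k)) ->
  measurable_fun setT (fun x => \sum_(k | P k) f k x).
Proof.
move=> mf; rewrite (_ : (fun x => _) = (fun x => \sum_(k <- enum P) f k x)).
  exact: measurable_sum.
by apply/funext => x; rewrite big_enum.
Qed.

Let Phi (z : 'rV[R]_n) := \sum_(k | P k) gauss (z - y k).

Let window k : set R := `[start b S0 k, start b S0 k + M]%classic.

Let mwindow k : measurable (window k). Proof. exact: measurable_itv. Qed.

Let leb_window k : leb (window k) = M%:E.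
Proof.
by rewrite /window lebesgue_measure_itv/= lte_fin ltrDl M0 -EFinB addrAC subrr add0r.
Qed.

Let mindic k : measurable_fun setT (\1_(window k) : measurableTypeR R -> R).
Proof. apply: measurable_indic; exact: mwindow. Qed.

Let H (z : 'rV[R]_n) (s : R) := \sum_(k | P k) gauss (z - y k) * \1_(window k) s.

Let source_le z s : Normc.normc (source P y b M S0 (z, s)) <= H z s.
Proof.
rewrite /source (le_trans (normc_sum _ _ _))//; apply: ler_sum => k _.
rewrite -[(z, s).1]/z -[(z, s).2]/s /amplitude /profile.
rewrite !Normc.normcM normc_cexpi mul1r !normc_real !ger0_norm ?bump_ge0 ?gauss_ge0//.
rewrite mulrC ler_wpM2l ?gauss_ge0// indicE.
case: (boolP (s \in window k)) => [_|]; first exact: bump_le1.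
rewrite notin_setE /window/= in_itv/= => /negP h.
rewrite (_ : bump _ = 0)//; apply: (@profile_out R I b M S0 M0 k s).
by apply: contra h => /andP[/ltW -> /ltW ->].
Qed.

Let H_le z s : H z s <= Phi z.
Proof.
apply: ler_sum => k _; rewrite indicE.
by case: (_ \in _); rewrite ?mulr1 ?mulr0 ?gauss_ge0.
Qed.

Let H_ge0 z s : 0 <= H z s.
Proof. by apply: sumr_ge0 => k _; rewrite mulr_ge0 ?gauss_ge0. Qed.

Let Phi_ge0 z : 0 <= Phi z. Proof. by apply: sumr_ge0 => k _; exact: gauss_ge0. Qed.

Let measurable_H z : measurable_fun setT (H z).
Proof.
by apply: measurable_sumP => k; apply: measurable_funM.
Qed.

Let integral_H z : (\int[leb]_s (H z s)%:E = (M * Phi z)%:E)%E.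
Proof.
rewrite (eq_integral (fun s : measurableTypeR R =>
    (\sum_(k <- enum P) (gauss (z - y k) * \1_(window k) s)%:E)%E)); last first.
  by move=> s _; rewrite /H -big_enum/= -sumEFin.
rewrite ge0_integral_sum//; last 2 first.
- move=> k; apply/measurable_EFinP; apply: measurable_funM; first exact: measurable_cst.
  exact: mindic.
- by move=> k s _; rewrite lee_fin mulr_ge0 ?gauss_ge0.
rewrite (eq_bigr (fun k => (M * gauss (z - y k))%:E)); last first.
  move=> k _; under eq_integral do rewrite EFinM.
  rewrite ge0_integralZl_EFin ?gauss_ge0//; last first.
    by apply/measurable_EFinP; exact: mindic.
  rewrite integral_indic; [|exact: measurableT|exact: mwindow].
  by rewrite setIT [X in (_ * X)%E](leb_window k) -EFinM mulrC.
by rewrite sumEFin -mulr_sumr big_enum.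
Qed.

(** The source is dominated by the sum H of the Gaussians times the indicators of
their time windows, and H z is at most Phi z, the sum of all the Gaussians, with
integral M Phi z in time.  Interpolation gives M^(1/q) Phi z for the inner norm,
and interpolating Phi between its supremum and its integral gives the outer
one. *)
Lemma mixed_norm_source (r q : \bar R) (D : R) : (1 <= r)%E -> (1 <= q)%E -> 0 < D ->
  (forall z, \sum_(k | P k) gauss (z - y k) <= D) ->
  (mixed_norm r q (source P y b M S0) <=
   (M `^ inv_exponent q * D *
     ((\sum_(k | P k) 1) * Num.sqrt (4 * pi) ^+ n / D) `^ inv_exponent r)%:E)%E.
Proof.
move=> r1 q1 D0 PhiD; rewrite /mixed_norm.
have Mq : 0 <= M `^ inv_exponent q by exact: powR_ge0.
pose G z := M `^ inv_exponent q * Phi z.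
apply: (@le_trans _ _ (Lnorm (lebesgue_rV R n) r (EFin \o G))).
  apply: le_Lnorm => // z; rewrite gee0_abs ?Lnorm_ge0//.
  rewrite /G /= ger0_norm ?mulr_ge0//.
  apply: (@le_trans _ _ (Lnorm leb q (EFin \o H z))).
    apply: le_Lnorm => // s; rewrite !gee0_abs ?lee_fin ?normc_ge0//.
  have := @Lnorm_upper _ _ R leb q (H z) (Phi z) M q1 (measurable_H z) (Phi_ge0 z)
    (ltW M0) (H_ge0 z) (H_le z).
  by rewrite integral_H [Phi z * _]mulrC; apply.
have mG : measurable_fun setT G.
  apply: measurable_funM => //; apply: measurable_sumP => k.
  by have /integrableP[/measurable_EFinP] := (integral_gauss (y k)).1.
apply: Lnorm_upper => //.
- by rewrite mulr_ge0// ltW.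
- rewrite divr_ge0 ?(ltW D0)// mulr_ge0 ?exprn_ge0 ?sqrtr_ge0//.
  exact: sumr_ge0.
- by move=> z; rewrite mulr_ge0.
- by move=> z; rewrite ler_wpM2l// PhiD.
rewrite (eq_integral (fun z : 'rV[R]_n => (M `^ inv_exponent q)%:E *
    \sum_(k <- enum P) (gauss (z - y k))%:E)%E); last first.
  by move=> z _; rewrite /G EFinM; congr (_ * _)%E; rewrite sumEFin big_enum.
have mg k : measurable_fun setT (fun z : 'rV[R]_n => (gauss (z - y k))%:E).
  by have /integrableP[] := (integral_gauss (y k)).1.
rewrite ge0_integralZl_EFin//; last 2 first.
- by move=> z _; apply: sume_ge0 => k _; rewrite lee_fin gauss_ge0.
- by apply: emeasurable_sum => k.
rewrite ge0_integral_sum//; last by move=> k z _; rewrite lee_fin gauss_ge0.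
rewrite (eq_bigr (fun k => (Num.sqrt (4 * pi) ^+ n)%:E)); last first.
  move=> k _; have [i1 i2] := integral_gauss (y k).
  by rewrite -i2 /Rintegral fineK//; exact: integrable_fin_num.
rewrite sumEFin -EFinM lee_fin big_enum.
rewrite -[X in _ * X <= _](mulfVK (lt0r_neq0 D0)).
rewrite [X in X <= _](_ : _ = (\sum_(k | P k) 1) * Num.sqrt (4 * pi) ^+ n / D * (M `^ inv_exponent q * D))//.
rewrite mulr_suml; under [in RHS]eq_bigr do rewrite mul1r.
by rewrite mulrCA.
Qed.

End source_norm.

(** * Lower bound for the Duhamel integral *)
Section duhamel_lower.
Context (R : realType).
Local Notation C := (R[i]).
Notation leb := (@lebesgue_measure R).

Let continuous_D : continuous (fun t : R => 1 + t ^+ 2).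
Proof.
by move=> t; apply: cvgD; [exact: cvg_cst|exact: exprn_continuous].
Qed.

Let D_gt0 (t : R) : 0 < 1 + t ^+ 2.
Proof. by rewrite ltr_wpDr ?sqr_ge0. Qed.

Let continuous_DV : continuous (fun t : R => (4 * (1 + t ^+ 2))^-1).
Proof.
move=> t; apply: cvgV; first by rewrite mulf_neq0 ?lt0r_neq0.
by apply: cvgM; [exact: cvg_cst|exact: continuous_D].
Qed.

Lemma continuous_bigsum (J : Type) (s : seq J) (Q : pred J) (g : J -> R -> R) :
  (forall k, continuous (g k)) -> continuous (fun u : R => \sum_(k <- s | Q k) g k u).
Proof.
move=> cg; elim: s => [|k s IH].
  rewrite (_ : (fun u => _) = cst 0); first exact: cst_continuous.
  by apply/funext => u; rewrite big_nil.
case: (boolP (Q k)) => Qk.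
  rewrite (_ : (fun u => _) = (fun u => g k u + \sum_(j <- s | Q j) g j u)).
    by move=> u; apply: cvgD; [exact: cg|exact: IH].
  by apply/funext => u; rewrite big_cons Qk.
rewrite (_ : (fun u => _) = (fun u => \sum_(j <- s | Q j) g j u))//.
by apply/funext => u; rewrite big_cons (negbTE Qk).
Qed.

Lemma continuous_gauss_modulus n (w : 'rV[R]_n) : continuous (fun t : R => gauss_modulus t w).
Proof.
move=> t; apply: (@continuous_comp _ _ _ (fun t : R =>
  - (n%:R * ln (1 + t ^+ 2) / 4) - dot_rV w w / (4 * (1 + t ^+ 2))) expR); last exact: continuous_expR.
apply: cvgB; last by apply: cvgM; [exact: cvg_cst|exact: continuous_DV].
apply: cvgN; apply: cvgM; last exact: cvg_cst.
apply: cvgM; first exact: cvg_cst.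
by apply: (@continuous_comp _ _ _ (fun t : R => 1 + t ^+ 2) (@ln R));
  [exact: continuous_D|exact: continuous_ln].
Qed.

Lemma continuous_gauss_phase n (w : 'rV[R]_n) : continuous (fun t : R => gauss_phase t w).
Proof.
move=> t; apply: cvgB.
  apply: cvgM; last exact: continuous_DV.
  by apply: cvgM; [exact: cvg_id|exact: cvg_cst].
by apply: cvgM; [apply: cvgM; [exact: cvg_cst|exact: continuous_atan]|exact: cvg_cst].
Qed.

Lemma normc_ge_rotation (z : C) (a : R) :
  cos a * complex.Re z + sin a * complex.Im z <= Normc.normc z.
Proof.
case: z => u v /=; set e := _ + _.
rewrite (le_trans (ler_norm e))// -sqrtr_sqr ler_sqrt ?addr_ge0 ?sqr_ge0//.
have -> : e ^+ 2 = u ^+ 2 + v ^+ 2 - (sin a * u - cos a * v) ^+ 2.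
  transitivity ((u ^+ 2 + v ^+ 2) * (cos a ^+ 2 + sin a ^+ 2) - (sin a * u - cos a * v) ^+ 2).
    by rewrite /e; ring.
  by rewrite cos2Dsin2 mulr1.
by rewrite lerBlDr lerDl sqr_ge0.
Qed.

Context (n : nat) (I : finType) (P : pred I) (y : I -> 'rV[R]_n) (b : I -> R) (M S0 : R).
Hypothesis M0 : 0 < M.

Definition total_phase k (t : R) (x : 'rV[R]_n) (s : R) :=
  - (s / 4) - b k / 2 + gauss_phase (t - s) (x - y k).

(** Project the integral on the direction exp(i a).  Every packet contributes a
nonnegative amount to the projection, and during the middle half of its time
window, of length M/2, it contributes at least exp(-8) m / 2, as the bump is at
least exp(-8) there. *)
Lemma duhamel_lower (t : R) (x : 'rV[R]_n) (a m : R) : 0 <= t -> 0 <= m ->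
  (forall k, P k -> 0 <= start b S0 k /\ start b S0 k + M <= t) ->
  (forall k s, P k -> start b S0 k <= s <= start b S0 k + M ->
     1 / 2 <= cos (total_phase k t x s - a) /\ m <= gauss_modulus (t - s) (x - y k)) ->
  (\sum_(k | P k) 1) * (M / 2 * (expR (- 8) * m / 2)) <=
    Normc.normc (duhamel (source P y b M S0) (x, t)).
Proof.
move=> t0 m0 Pt Pcos.
pose f s : C := \sum_(k | P k) amplitude b M S0 k s * gauss_evolution (t - s) (x - y k).
have duE : duhamel (source P y b M S0) (x, t) = Cintegral leb `[0, t]%classic f.
  rewrite /duhamel /Cintegral_ab /= t0; congr Cintegral; apply/funext => s.
  exact: (@schrodinger_gauss_sum R n (t - s) I P (fun k => amplitude b M S0 k s) y x).
pose p k s := profile b M S0 k s * gauss_modulus (t - s) (x - y k).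
pose th k s := total_phase k t x s.
have fE s : f s = \sum_(k | P k) (p k s)%:C%C * cexpi (th k s).
  apply: eq_bigr => k _.
  rewrite (_ : cexpi (th k s) =
    cexpi (- (s / 4) - b k / 2) * cexpi (gauss_phase (t - s) (x - y k))); last exact: cexpiD.
  rewrite (_ : (p k s)%:C%C =
    (profile b M S0 k s)%:C%C * (gauss_modulus (t - s) (x - y k))%:C%C); last exact: rmorphM.
  rewrite /amplitude /gauss_evolution.
  move: (cexpi _) (cexpi _) ((profile _ _ _ _ _)%:C%C) ((gauss_modulus _ _)%:C%C) => A B u v.
  by rewrite [B * u]mulrC mulrACA.
have RefE s : complex.Re (f s) = \sum_(k | P k) p k s * cos (th k s).
  rewrite fE Re_sum; apply: eq_bigr => k _; by rewrite mulrC ReMr mulrC.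
have ImfE s : complex.Im (f s) = \sum_(k | P k) p k s * sin (th k s).
  rewrite fE Im_sum; apply: eq_bigr => k _; by rewrite mulrC ImMr mulrC.
have csh : continuous (fun s : R => t - s).
  by move=> s; apply: cvgB; [exact: cvg_cst|exact: cvg_id].
have cp k : continuous (p k).
  move=> s; apply: cvgM.
    apply: (@continuous_comp _ _ _ (fun s : R => (s - start b S0 k) / M) (@bump R)); last exact: continuous_bump.
    by apply: cvgM; [apply: cvgB; [exact: cvg_id|exact: cvg_cst]|exact: cvg_cst].
  by apply: (@continuous_comp _ _ _ (fun s : R => t - s) (fun u => gauss_modulus u (x - y k)));
    [exact: csh|exact: continuous_gauss_modulus].
have cth k : continuous (th k).
  move=> s; apply: cvgD.
    apply: cvgB; last exact: cvg_cst.
    by apply: cvgN; apply: cvgM; [exact: cvg_id|exact: cvg_cst].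
  by apply: (@continuous_comp _ _ _ (fun s : R => t - s) (fun u => gauss_phase u (x - y k)));
    [exact: csh|exact: continuous_gauss_phase].
have int (g : R -> R) : continuous g -> leb.-integrable `[0, t]%classic (fun s => (g s)%:E).
  move=> cg; apply: continuous_compact_integrable; first exact: segment_compact.
  exact: continuous_subspaceT.
have iRe : leb.-integrable `[0, t]%classic (fun s => (complex.Re (f s))%:E).
  rewrite (_ : (fun s => _) = (fun s : measurableTypeR R => (\sum_(k | P k) p k s * cos (th k s))%:E)); last first.
    by apply/funext => s; congr (_%:E); exact: RefE.
  apply: int => s; move: s; apply: continuous_bigsum => k s; apply: cvgM; first exact: cp.
  by apply: (@continuous_comp _ _ _ (th k) (@cos R)); [exact: cth|exact: continuous_cos].
have iIm : leb.-integrable `[0, t]%classic (fun s => (complex.Im (f s))%:E).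
  rewrite (_ : (fun s => _) = (fun s : measurableTypeR R => (\sum_(k | P k) p k s * sin (th k s))%:E)); last first.
    by apply/funext => s; congr (_%:E); exact: ImfE.
  apply: int => s; move: s; apply: continuous_bigsum => k s; apply: cvgM; first exact: cp.
  by apply: (@continuous_comp _ _ _ (th k) (@sin R)); [exact: cth|exact: continuous_sin].
have mI : measurable (`[0, t]%classic : set (measurableTypeR R)) by exact: measurable_itv.
have [ih hE] := integrable_comb (cos a) (sin a) mI iRe iIm.
rewrite duE (le_trans _ (normc_ge_rotation _ a))//= -hE.
pose J k : set R := `[start b S0 k + M / 4, start b S0 k + 3 * M / 4]%classic.
have hh s : cos a * complex.Re (f s) + sin a * complex.Im (f s) =
    \sum_(k | P k) p k s * cos (th k s - a).
  rewrite RefE ImfE !mulr_sumr -big_split/=; apply: eq_bigr => k _.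
  by rewrite cosB; ring.
pose c := expR (- 8) * m / 2.
have c0 : 0 <= c by rewrite /c !mulr_ge0 ?expR_ge0.
have low s : \sum_(k | P k) c * \1_(J k) s <= cos a * complex.Re (f s) + sin a * complex.Im (f s).
  rewrite hh; apply: ler_sum => k Pk; rewrite indicE.
  have [kin|kout] := boolP (start b S0 k < s < start b S0 k + M); last first.
    rewrite /p profile_out// !mul0r memNset ?mulr0// /J/= in_itv/=.
    move: kout => /negP kout /andP[h1 h2]; apply: kout; apply/andP; split; move: M0 h1 h2; lra.
  have kin' : start b S0 k <= s <= start b S0 k + M.
    by case/andP: kin => /ltW -> /ltW ->.
  have [hc hm] := Pcos k s Pk kin'; rewrite -/(th k s) in hc.
  have p0 : 0 <= p k s by rewrite mulr_ge0 ?bump_ge0 ?expR_ge0.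
  case: (boolP (s \in J k)) => [|_]; last first.
    by rewrite mulr0 mulr_ge0// (le_trans _ hc).
  rewrite inE /J/= in_itv/= => /andP[h1 h2].
  rewrite mulr1 /c ler_pM//; first by rewrite mulr_ge0 ?expR_ge0.
    rewrite ler_pM ?expR_ge0// bump_in//.
    rewrite ler_pdivlMr// ler_pdivrMr//; apply/andP; split; move: h1 h2; lra.
  by move: hc; lra.
have mJ k : measurable (J k : set (measurableTypeR R)) by exact: measurable_itv.
have JI k : P k -> J k `&` `[0, t]%classic = J k.
  move=> Pk; apply/setIidl => s /=; rewrite !in_itv/= => /andP[h1 h2].
  move: h1 h2; rewrite !bnd_simp => h1 h2.
  have [s0 st] := Pt k Pk; apply/andP; split; move: M0 h1 h2 s0 st; lra.
have lebJ k : leb (J k) = (M / 2)%:E.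
  rewrite /J lebesgue_measure_itv/= lte_fin ltrD2l.
  rewrite ifT; last by move: M0; lra.
  by rewrite -EFinB; congr (_%:E); field.
have ind k : leb.-integrable `[0, t]%classic (fun s => (\1_(J k) s)%:E).
  apply/integrableP; split.
    apply/measurable_EFinP/measurable_funTS; exact: (measurable_indic (mJ k)).
  rewrite (eq_integral (fun s : measurableTypeR R => (\1_(J k) s)%:E)); last first.
    by move=> s _; rewrite gee0_abs// lee_fin.
  rewrite integral_indic; [|exact: mI|exact: mJ].
  apply: (@le_lt_trans _ _ (leb (J k))); last by rewrite lebJ ltry.
  apply: le_measure; rewrite ?inE; [exact: measurableI|exact: mJ|exact: subIsetl].
have iJ k : leb.-integrable `[0, t]%classic (fun s => (c * \1_(J k) s)%:E).
  rewrite (_ : (fun s => _) = (fun s : measurableTypeR R => c%:E * (\1_(J k) s)%:E)%E); last first.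
    by apply/funext => s; exact: EFinM.
  by apply: integrableZl => //; exact: ind.
have isum : leb.-integrable `[0, t]%classic (fun s => (\sum_(k | P k) c * \1_(J k) s)%:E).
  have -> : (fun s => (\sum_(k | P k) c * \1_(J k) s)%:E) =
     (fun s : measurableTypeR R => (\sum_(k <- enum P) (c * \1_(J k) s)%:E)%E).
    by apply/funext => s; rewrite sumEFin big_enum.
  exact: (@integrable_sum _ _ _ leb _ mI I (enum P) xpredT
    (fun k (s : measurableTypeR R) => (c * \1_(J k) s)%:E) (fun k _ => iJ k)).
apply: le_trans (le_Rintegral mI isum ih (fun s _ => low s)).
rewrite /Rintegral.
rewrite [X in fine X](_ : _ = ((\sum_(k | P k) 1) * (M / 2 * c))%:E)//.
  rewrite (eq_integral (fun s : measurableTypeR R =>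
    (\sum_(k <- enum P) (c * \1_(J k) s)%:E)%E)); last first.
    by move=> s _; rewrite sumEFin big_enum.
  rewrite (@integral_sum _ _ _ leb _ mI _ (fun k (s : measurableTypeR R) => (c * \1_(J k) s)%:E))//.
  rewrite big_seq_cond (eq_bigr (fun k => (M / 2 * c)%:E)); last first.
    move=> k; rewrite andbT mem_enum => Pk.
    rewrite (eq_integral (fun s : measurableTypeR R => c%:E * (\1_(J k) s)%:E)%E); last first.
      by move=> s _; exact: EFinM.
    rewrite integralZl; [|exact: mI|exact: ind].
    rewrite integral_indic; [|exact: mI|exact: mJ]; rewrite JI// [X in (_ * X)%E](lebJ k) -EFinM mulrC.
    by [].
  rewrite -big_seq_cond sumEFin big_enum mulr_suml.
  by congr (_%:E); apply: eq_bigr => k _; rewrite mul1r.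
Qed.

End duhamel_lower.

(** * Phase and modulus of an evolved Gaussian on the light cone *)
Section coherence.
Context (R : realType).

Lemma ler_sin_norm (t : R) : `|sin t| <= `|t|.
Proof.
have pos (u : R) : 0 < u -> `|sin u| <= u.
  move=> u0.
  have [c _] := @MVT R sin cos 0 u u0 (fun x _ => is_derive_sin x)
    (continuous_subspaceT (@continuous_sin R)).
  rewrite sin0 !subr0 => ->; by rewrite normrM (gtr0_norm u0) ler_piMl ?(ltW u0)// cos_max.
have [t0|t0|->] := ltgtP t 0; last by rewrite sin0.
  by rewrite -normrN -sinN -[leRHS]normrN (gtr0_norm (_ : 0 < - t)) ?oppr_gt0// pos ?oppr_gt0.
by rewrite (gtr0_norm t0) pos.
Qed.

Lemma cos_ge_half (t : R) : `|t| <= 1 -> 1 / 2 <= cos t.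
Proof.
move=> t1.
have -> : cos t = 1 - 2 * sin (t / 2) ^+ 2.
  have -> : cos t = cos (t / 2 + t / 2) by congr cos; lra.
  rewrite cosD -!expr2; have := cos2Dsin2 (t / 2); lra.
have h : `|sin (t / 2)| <= 1 / 2.
  by rewrite (le_trans (ler_sin_norm _))// normrM [`|2^-1|]gtr0_norm; lra.
have -> : sin (t / 2) ^+ 2 = `|sin (t / 2)| ^+ 2 by rewrite real_normK// num_real.
have := normr_ge0 (sin (t / 2)); nra.
Qed.

Lemma atan_near_pihalf (c : R) : 0 <= c ->
  exists T0 : R, forall t, T0 <= t -> 0 <= c * (pi / 2 - atan t) <= 1 / 4.
Proof.
move=> c0; have e0 : 0 < (4 * (1 + c))^-1 by rewrite invr_gt0 mulr_gt0// ltr_wpDr.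
have /cvgrPdist_lt/(_ _ e0) := @cvgy_atan R.
move=> [T0 [_ hT]]; exists (T0 + 1) => t tT.
have ht : pi / 2 - atan t < (4 * (1 + c))^-1.
  by rewrite (le_lt_trans (ler_norm _))// hT// (lt_le_trans _ tT)// ltrDl.
have h0 : 0 <= pi / 2 - atan t by rewrite subr_ge0 ltW// atan_ltpi2.
rewrite mulr_ge0//= (le_trans (ler_wpM2l c0 (ltW ht)))//.
by rewrite ler_pdivrMr ?mulr_gt0 ?ltr_wpDr//; lra.
Qed.

(** The total phase differs from A/2 - t/4 - n pi/4 by the four terms
(d - A - B)/2, (tau - d)^2/(4 tau), - d^2/(4 tau (1 + tau^2)) and
(n/2) (pi/2 - atan tau), bounded by 1/4, 1/16, 1/16 and 1/4. *)
Lemma phase_error (A B d s t M : R) (n : nat) (w : 'rV[R]_n) :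
  let tau := t - s in
  0 < tau -> 0 <= d -> d ^+ 2 = dot_rV w w ->
  `|d - A - B| <= 1 / 2 -> `|tau - d| <= 2 * M -> 16 * M ^+ 2 <= tau ->
  16 <= tau -> d <= 2 * tau ->
  0 <= n%:R / 2 * (pi / 2 - atan tau) <= 1 / 4 ->
  `|- (s / 4) - B / 2 + gauss_phase tau w - (A / 2 - t / 4 - n%:R * pi / 4)| <= 1.
Proof.
move=> tau tau0 d0 dE dAB taud tauM tau16 dtau /andP[at0 at1].
have tn0 : tau != 0 by rewrite gt_eqF.
have D0 : 0 < 1 + tau ^+ 2 by rewrite ltr_wpDr ?sqr_ge0.
have -> : - (s / 4) - B / 2 + gauss_phase tau w - (A / 2 - t / 4 - n%:R * pi / 4) =
    (d - A - B) / 2 + (tau - d) ^+ 2 / (4 * tau) - d ^+ 2 / (4 * tau * (1 + tau ^+ 2))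
    + n%:R / 2 * (pi / 2 - atan tau).
  rewrite /gauss_phase -dE (_ : t = tau + s); last by rewrite /tau subrK.
  have Dn0 := lt0r_neq0 D0; field.
  by rewrite tn0 Dn0.
have e1 : 0 <= (tau - d) ^+ 2 / (4 * tau) <= 1 / 16.
  rewrite divr_ge0 ?sqr_ge0 ?mulr_ge0 ?(ltW tau0)//= ler_pdivrMr ?mulr_gt0//.
  rewrite -real_normK ?num_real//.
  have := normr_ge0 (tau - d); move: taud tauM; nra.
have e2 : 0 <= d ^+ 2 / (4 * tau * (1 + tau ^+ 2)) <= 1 / 16.
  rewrite divr_ge0 ?sqr_ge0 ?mulr_ge0 ?(ltW tau0) ?(ltW D0)//= ler_pdivrMr ?mulr_gt0//.
  apply: (@le_trans _ _ (4 * tau ^+ 2)); first by move: d0 dtau; nra.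
  have : 0 <= tau ^+ 2 by exact: sqr_ge0.
  nra.
move: dAB e1 e2 at0 at1; rewrite !ler_norml => /andP[h1 h2] /andP[h3 h4] /andP[h5 h6] h7 h8.
by apply/andP; split; lra.
Qed.

(** (1 + tau^2)^(-n/4) is at least (1 + u^2)^(-n/4) M^-n, and the Gaussian factor is
at least exp(-1) because d^2 <= 4 tau^2. *)
Lemma modulus_ge (tau d u M : R) (n : nat) (w : 'rV[R]_n) :
  0 < tau -> 0 <= d -> d ^+ 2 = dot_rV w w -> d <= 2 * tau -> tau <= u * M ^+ 2 ->
  1 <= M ->
  expR (- (n%:R * ln (1 + u ^+ 2) / 4) - 1) / M ^+ n <= gauss_modulus tau w.
Proof.
move=> tau0 d0 dE dtau tauu M1.
have M0 : 0 < M by lra.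
have uM0 : 0 < u * M ^+ 2 by exact: lt_le_trans tauu.
have D0 : 0 < 1 + tau ^+ 2 by rewrite ltr_wpDr ?sqr_ge0.
have -> : M ^+ n = expR (n%:R * ln M) by rewrite expRM_natl lnK.
rewrite -expRN -expRD ler_expR.
have e1 : dot_rV w w / (4 * (1 + tau ^+ 2)) <= 1.
  rewrite ler_pdivrMr ?mulr_gt0// -dE; move: d0 dtau; nra.
have e2 : ln (1 + tau ^+ 2) <= ln (1 + u ^+ 2) + 4 * ln M.
  have -> : 4 * ln M = ln (M ^+ 4) by rewrite lnXn// mulr_natl.
  rewrite -lnM ?posrE ?exprn_gt0 ?ltr_wpDr ?sqr_ge0//.
  rewrite ler_ln ?posrE// ?mulr_gt0 ?exprn_gt0 ?ltr_wpDr ?sqr_ge0//.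
  rewrite mulrDl mul1r lerD ?exprn_ege1//.
  rewrite -[4%N]/(2 * 2)%N exprM -exprMn lerXn2r ?nnegrE ?(ltW tau0) ?(ltW uM0)//.
have n0 : 0 <= n%:R :> R by [].
have := ler_wpM2l n0 e2; lra.
Qed.

End coherence.

(** * From coherent configurations to exponent conditions *)
Section scaling.
Context (R : realType).
Notation C := R[i].
Notation leb := (@lebesgue_measure R).

Definition euclid n (w : 'rV[R]_n) : R := Num.sqrt (dot_rV w w).

Lemma dot_ge0 n (w : 'rV[R]_n) : 0 <= dot_rV w w.
Proof. by apply: sumr_ge0 => i _; rewrite -expr2 sqr_ge0. Qed.

Lemma euclid_ge0 n (w : 'rV[R]_n) : 0 <= euclid w.
Proof. exact: sqrtr_ge0. Qed.

Lemma euclid_sqr n (w : 'rV[R]_n) : euclid w ^+ 2 = dot_rV w w.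
Proof. by rewrite sqr_sqrtr// dot_ge0. Qed.

(** N centres y_k and a receiving set E of volume V at distances of order M^2 from
them; the distance splits as a(x) + b_k up to 1/2.  The bound D on the sum of the
Gaussians says that the centres are separated, and S0 is large enough for all
emissions to start at nonnegative times.  The constant 18 leaves tau >= 16 M^2
for every tau with |tau - d| <= 2M, as soon as M >= 1. *)
Definition coherent (n : nat) (u D M N V : R) : Prop :=
  exists (I : finType) (P : pred I) (y : I -> 'rV[R]_n) (b : I -> R) (S0 : R)
    (E : set 'rV[R]_n) (a : 'rV[R]_n -> R),
  [/\ measurable E /\ lebesgue_rV R n E = V%:E,
      \sum_(k | P k) 1 = N,
      (forall z, \sum_(k | P k) gauss (z - y k) <= D),
      (forall k, P k -> b k <= S0) &
      forall k x, P k -> E x ->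
        `|euclid (x - y k) - a x - b k| <= 1 / 2 /\
        18 * M ^+ 2 <= euclid (x - y k) <= u * M ^+ 2].

(** The assumed estimate for the source.  Its left-hand side is bounded below by
Chebyshev, first in time and then in space. *)
Lemma coherent_bound (n : nat) (q r q1 r1 : \bar R) (K u D M N V : R) :
  (1 <= q)%E -> (1 <= r)%E -> (1 <= q1)%E -> (1 <= r1)%E ->
  (forall F : 'rV[R]_n * R -> C, schwartz F ->
      (mixed_norm r q (duhamel F) <= K%:E * mixed_norm r1 q1 F)%E) ->
  1 <= M -> (forall t, M <= t -> 0 <= n%:R / 2 * (pi / 2 - atan t) <= 1 / 4) ->
  0 < D -> 0 < N -> 0 < V -> coherent n u D M N V ->
  N * (M / 2 * (expR (- 8) *
     (expR (- (n%:R * ln (1 + (u + 2) ^+ 2) / 4) - 1) / M ^+ n) / 2)) *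
    M `^ inv_exponent q * V `^ inv_exponent r <=
  `|K| * (M `^ inv_exponent q1 * D * (N * Num.sqrt (4 * pi) ^+ n / D) `^ inv_exponent r1).
Proof.
move=> q_ge1 r_ge1 q1_ge1 r1_ge1 hK M1 hat D0 N0 V0
  [I [P [y [b [S0 [E [a [[mE EV] PN PD Pb hE]]]]]]]].
have M0 : 0 < M by lra.
have MM : M <= M ^+ 2 by rewrite expr2 ler_peMl// ltW.
pose F := source P y b M S0.
set m := expR _ / M ^+ n; set L := N * _.
have m0 : 0 <= m by rewrite divr_ge0 ?expR_ge0 ?exprn_ge0// ltW.
have L0 : 0 <= L.
  by apply: mulr_ge0; [lra|apply: mulr_ge0; [lra|]]; apply: divr_ge0 => //;
    apply: mulr_ge0 => //; exact: expR_ge0.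
have [k0 Pk0] : exists k, P k.
  apply/not_existsP => nP; move: N0; rewrite -PN big1 ?ltxx// => k Pk.
  by have := nP k; rewrite Pk.
have dlow x (t : R) : E x -> S0 + a x <= t <= S0 + a x + M ->
    L <= Normc.normc (duhamel F (x, t)).
  move=> Ex /andP[t1 t2]; rewrite /L -PN.
  apply: (@duhamel_lower _ _ _ _ _ _ _ _ _ _ _ (a x / 2 - t / 4 - n%:R * pi / 4)) => //.
  - have [+ /andP[+ _]] := hE _ _ Pk0 Ex; rewrite ler_norml => /andP[h1 h2] h3.
    have := Pb _ Pk0; lra.
  - move=> k Pk; have [+ /andP[+ _]] := hE _ _ Pk Ex; rewrite ler_norml.
    move=> /andP[h1 h2] h3; have := Pb _ Pk; rewrite /start; split; lra.
  - move=> k s Pk; rewrite /start => /andP[s1 s2].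
    have [] := hE _ _ Pk Ex; have := euclid_sqr (x - y k); have := euclid_ge0 (x - y k).
    set d := euclid _ => d0 dE dab /andP[dM du].
    have td : `|t - s - d| <= 2 * M.
      move: dab; rewrite !ler_norml => /andP[h1 h2]; apply/andP; split; lra.
    have [td1 td2] : d - 2 * M <= t - s /\ t - s <= d + 2 * M.
      by move: td; rewrite ler_norml => /andP[h1 h2]; split; lra.
    have ts0 : 0 < t - s by lra.
    split.
      apply: cos_ge_half; rewrite /total_phase.
      apply: (@phase_error _ (a x) (b k) d s t M n) => //; try lra.
      by apply: hat; lra.
    by apply: (@modulus_ge _ (t - s) d) => //; lra.
have mixlow : ((L * M `^ inv_exponent q * V `^ inv_exponent r)%:E <=
    mixed_norm r q (duhamel F))%E.
  apply: (Lnorm_lower r_ge1 mE EV V0); first by rewrite mulr_ge0 ?powR_ge0.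
  move=> x Ex; rewrite gee0_abs ?Lnorm_ge0//.
  have wM : leb `[S0 + a x, S0 + a x + M]%classic = M%:E.
    by rewrite lebesgue_measure_itv/= lte_fin ltrDl M0 -EFinB addrAC subrr add0r.
  apply: (Lnorm_lower q_ge1 _ wM) => //.
  move=> t /=; rewrite in_itv/= => t12.
  by rewrite lee_fin ger0_norm ?normc_ge0// dlow.
rewrite -lee_fin (le_trans mixlow)// (le_trans (hK _ (schwartz_source _ _ _ _ M0)))//.
rewrite EFinM -PN; apply: (@le_trans _ _ (`|K|%:E * mixed_norm r1 q1 F)%E).
  by rewrite lee_wpmul2r ?Lnorm_ge0// lee_fin ler_norm.
by rewrite lee_wpmul2l ?lee_fin// mixed_norm_source.
Qed.

Lemma powR_natX (M e : R) (p : nat) : 0 < M -> (M ^+ p) `^ e = M `^ (p%:R * e).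
Proof. by move=> M0; rewrite -powR_mulrn ?(ltW M0)// -powRrM. Qed.

Lemma exponent_le (c c' e1 e2 : R) (m0 : nat) : 0 < c ->
  (forall m : nat, (m0 <= m)%N -> c * m%:R `^ e1 <= c' * m%:R `^ e2) -> e1 <= e2.
Proof.
move=> c0 h; rewrite leNgt; apply/negP => e21.
pose e := e1 - e2; have e0 : 0 < e by rewrite /e subr_gt0.
pose T := (`|c'| / c + 1) `^ e^-1.
have T0 : 0 < `|c'| / c + 1 by rewrite ltr_wpDl// divr_ge0// ltW.
pose m := (maxn m0 (Num.truncn T).+1).
have := h m (leq_maxl _ _); apply/negP; rewrite -ltNge.
have Tm : T <= m%:R.
  apply: (@le_trans _ _ ((Num.truncn T).+1)%:R); first by rewrite ltW// truncnS_gt.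
  by rewrite ler_nat leq_maxr.
have m_gt0 : 0 < m%:R :> R by rewrite (lt_le_trans _ Tm)// powR_gt0.
have -> : e1 = e + e2 by rewrite /e subrK.
have m_neq0 : m%:R != 0 :> R by rewrite gt_eqF.
rewrite powRD ?m_neq0 ?implybT// mulrA ltr_pM2r ?powR_gt0//.
have : T `^ e <= m%:R `^ e by rewrite ge0_ler_powR ?nnegrE ?powR_ge0// ltW.
rewrite -powRrM mulVf ?gt_eqF// powRr1 ?(ltW T0)// => h1.
apply: (@lt_le_trans _ _ (c * (`|c'| / c + 1))); last by rewrite ler_pM2l.
by rewrite mulrDr mulrCA divff ?gt_eqF// !mulr1 (le_lt_trans (ler_norm _))// ltrDl.
Qed.

(** Insert N = p0 M^p and V = v0 M^v into [coherent_bound] and compare powers of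
M. *)
Lemma scaling_condition (n p v : nat) (q r q1 r1 : \bar R) (K u D p0 v0 : R) (m0 : nat) :
  (1 <= q)%E -> (1 <= r)%E -> (1 <= q1)%E -> (1 <= r1)%E ->
  (forall F : 'rV[R]_n * R -> C, schwartz F ->
      (mixed_norm r q (duhamel F) <= K%:E * mixed_norm r1 q1 F)%E) ->
  0 < D -> 0 < p0 -> 0 < v0 ->
  (forall m : nat, (m0 <= m)%N -> coherent n u D m%:R (p0 * m%:R ^+ p) (v0 * m%:R ^+ v)) ->
  p%:R + 1 - n%:R + inv_exponent q + v%:R * inv_exponent r <=
    inv_exponent q1 + p%:R * inv_exponent r1.
Proof.
move=> q_ge1 r_ge1 q1_ge1 r1_ge1 hK D0 p00 v00 hm.
have [T hT] := @atan_near_pihalf R (n%:R / 2) (divr_ge0 (ler0n _ _) (ler0n _ _)).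
pose c := p0 * (1 / 2 * (expR (- 8) * expR (- (n%:R * ln (1 + (u + 2) ^+ 2) / 4) - 1) / 2))
  * v0 `^ inv_exponent r.
pose c' := `|K| * (D * (p0 * Num.sqrt (4 * pi) ^+ n / D) `^ inv_exponent r1).
have c0 : 0 < c by rewrite /c !mulr_gt0 ?expR_gt0 ?powR_gt0 ?invr_gt0.
apply: (@exponent_le c c' _ _ (maxn m0 (maxn 1 (Num.truncn T).+1))) => // m.
rewrite !geq_max => /andP[mm0 /andP[m1 mT]].
pose M : R := m%:R.
have M1 : 1 <= M by rewrite /M (ler_nat _ 1%N).
have M0 : 0 < M by lra.
have TM : T <= M.
  apply: (@le_trans _ _ ((Num.truncn T).+1)%:R); first by rewrite ltW// truncnS_gt.
  by rewrite ler_nat.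
have := coherent_bound q_ge1 r_ge1 q1_ge1 r1_ge1 hK M1
  (fun t Mt => hT t (le_trans TM Mt)) D0 _ _ (hm m mm0).
move=> /(_ (mulr_gt0 p00 (exprn_gt0 _ M0)) (mulr_gt0 v00 (exprn_gt0 _ M0))).
rewrite -/M (powRM _ (ltW v00) (exprn_ge0 _ (ltW M0))).
set X := (X in X <= _ -> _); set Y := (X in _ <= X -> _) => XY.
suff [-> ->] : c * M `^ (p%:R + 1 - n%:R + inv_exponent q + v%:R * inv_exponent r) = X /\
  c' * M `^ (inv_exponent q1 + p%:R * inv_exponent r1) = Y by [].
have Mn0 : M != 0 by rewrite gt_eqF.
split.
  rewrite /X /c powR_natX// powRD ?Mn0 ?implybT// powRD ?Mn0 ?implybT//.
  rewrite powRD ?Mn0 ?implybT// powRD ?Mn0 ?implybT// powRr1 ?(ltW M0)//.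
  rewrite powRN !powR_mulrn ?(ltW M0)//.
  by field; rewrite expf_neq0.
have Z0 : 0 <= p0 * Num.sqrt (4 * pi) ^+ n / D.
  by rewrite divr_ge0 ?(ltW D0)// mulr_ge0 ?(ltW p00)// exprn_ge0// sqrtr_ge0.
have -> : Y = `|K| * (M `^ inv_exponent q1 * D *
    (p0 * Num.sqrt (4 * pi) ^+ n / D * M ^+ p) `^ inv_exponent r1).
  by rewrite /Y; congr (_ * (_ * powR _ _)); ring.
rewrite (powRM _ Z0 (exprn_ge0 _ (ltW M0))) powR_natX// /c' powRD ?Mn0 ?implybT//.
ring.
Qed.

End scaling.

(** * Lattice configurations *)
Section lattice.
Context (R : realType).

(** exp(-u^2/4) <= 1/(1 + u^2/4), which is at most 12 times the derivative of atan
anywhere between u and u+1.  Sums over integer translates then telescope. *)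
Lemma gauss_le_atan (u : R) : expR (- u ^+ 2 / 4) <= 12 * (atan (u + 1) - atan u).
Proof.
have [c + ->] := @MVT R atan (fun x => (1 + x ^+ 2)^-1) u (u + 1) ltac:(by rewrite ltrDl)
  (fun x _ => is_derive1_atan x) (continuous_subspaceT (@continuous_atan R)).
rewrite in_itv/= => /andP[uc cu].
have c0 : 0 < 1 + c ^+ 2 by rewrite ltr_wpDr ?sqr_ge0.
have u0 : 0 < 1 + u ^+ 2 / 4 by rewrite ltr_wpDr// divr_ge0// sqr_ge0.
rewrite mulNr expRN addrAC subrr add0r mulr1 -[12]invrK -invfM lef_pV2 ?posrE ?expR_gt0//; last first.
  by rewrite mulr_gt0// invr_gt0.
apply: (le_trans _ (expR_ge1Dx _)).
rewrite mulrC ler_pdivrMr//.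
by have := sqr_ge0 (u - 1); have := sqr_ge0 u; nra.
Qed.

Lemma lattice_gauss_sum1 (z : R) (N : nat) :
  \sum_(j < N) expR (- (z - j%:R) ^+ 2 / 4) <= 12 * pi.
Proof.
apply: (@le_trans _ _ (12 * (atan (N%:R - z) - atan (- z)))); last first.
  rewrite ler_pM2l//; have := atan_ltpi2 (N%:R - z); have := atan_gtNpi2 (- z); lra.
elim: N => [|N IHN]; first by rewrite big_ord0 sub0r subrr mulr0.
rewrite big_ord_recr/=; have := gauss_le_atan (N%:R - z).
rewrite (_ : N%:R - z + 1 = N.+1%:R - z); last by rewrite -natr1; ring.
rewrite (_ : (N%:R - z) ^+ 2 = (z - N%:R) ^+ 2); last by ring.
by move: IHN; lra.
Qed.

Lemma dot_comb n (c e : R) (x y : 'rV[R]_n) :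
  dot_rV (c *: x + e *: y) (c *: x + e *: y) =
  c ^+ 2 * dot_rV x x + 2 * c * e * dot_rV x y + e ^+ 2 * dot_rV y y.
Proof.
rewrite /dot_rV !mulr_sumr -!big_split/=; apply: eq_bigr => i _; rewrite !mxE; ring.
Qed.

Lemma dot_le_euclid n (x y : 'rV[R]_n) : dot_rV x y <= euclid x * euclid y.
Proof.
have [x0|x0] := eqVneq (euclid x * euclid y) 0; last first.
  have xy0 : 0 < euclid x * euclid y by rewrite lt_neqAle eq_sym x0 mulr_ge0 ?euclid_ge0.
  have := dot_ge0 (euclid y *: x + (- euclid x) *: y).
  rewrite dot_comb -!euclid_sqr => h; rewrite -(ler_pM2l xy0).
  move: h; set s := dot_rV x y; set e := euclid x; set f := euclid y => h; lra.
have z n' (w v : 'rV[R]_n') : euclid w = 0 -> dot_rV w v = 0.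
  move=> /(congr1 (fun u => u ^+ 2)); rewrite euclid_sqr expr0n/= => /eqP.
  rewrite psumr_eq0 => [/allP h|i _]; last by rewrite -expr2 sqr_ge0.
  apply: big1 => i _; have := h i (mem_index_enum _).
  by rewrite /= mulf_eq0 orbb => /eqP ->; rewrite mul0r.
rewrite x0; move/eqP: x0; rewrite mulf_eq0 => /orP[/eqP/z ->//|/eqP/z h].
by rewrite /dot_rV (eq_bigr (fun i => y ord0 i * x ord0 i)) ?[X in X <= _](h x)// => i _; rewrite mulrC.
Qed.

Lemma euclid_triangle n (x y : 'rV[R]_n) : euclid (x + y) <= euclid x + euclid y.
Proof.
have h : 0 <= euclid x + euclid y by rewrite addr_ge0 ?euclid_ge0.
rewrite -(ler_pXn2r (ltn0Sn 1)) ?nnegrE ?euclid_ge0//.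
rewrite euclid_sqr -[x]scale1r -[y]scale1r dot_comb !scale1r sqrrD !euclid_sqr.
have := dot_le_euclid x y; lra.
Qed.

Lemma euclidN n (x : 'rV[R]_n) : euclid (- x) = euclid x.
Proof. by rewrite /euclid /dot_rV; congr Num.sqrt; apply: eq_bigr => i _; rewrite !mxE mulrNN. Qed.

Lemma euclid_le_sum n (x : 'rV[R]_n) : euclid x <= \sum_i `|x ord0 i|.
Proof.
have h : 0 <= \sum_i `|x ord0 i| by exact: sumr_ge0.
rewrite -(ler_pXn2r (ltn0Sn 1)) ?nnegrE ?euclid_ge0//.
rewrite euclid_sqr expr2 mulr_suml; apply: ler_sum => i _.
rewrite -expr2 -real_normK ?num_real// expr2 ler_wpM2l//.
by rewrite (bigD1 i)//= lerDl sumr_ge0.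
Qed.

Lemma coord_le_euclid n (x : 'rV[R]_n) i : x ord0 i <= euclid x.
Proof.
have [x0|x0] := leP 0 (x ord0 i); last by rewrite (le_trans (ltW x0))// euclid_ge0.
rewrite -(ler_pXn2r (ltn0Sn 1)) ?nnegrE ?euclid_ge0//.
rewrite euclid_sqr /dot_rV (bigD1 i)//= -expr2 lerDl sumr_ge0// => j _.
by rewrite -expr2 sqr_ge0.
Qed.

(** Centres on the unit lattice in one box and receiving points in another.  The
sum of the Gaussians is a product of one-dimensional lattice sums, each at most
12 pi. *)
Lemma coherent_boxes n (u M S0 : R) (l w o : 'I_n -> R) (m : 'I_n -> nat)
    (a b : 'rV[R]_n -> R) :
  (forall i, 0 <= w i) ->
  (forall x y : 'rV[R]_n, (forall i, l i <= x ord0 i <= l i + w i) ->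
    (forall i, o i <= y ord0 i <= o i + (m i)%:R - 1) ->
    [/\ b y <= S0, `|euclid (x - y) - a x - b y| <= 1 / 2 &
        18 * M ^+ 2 <= euclid (x - y) <= u * M ^+ 2]) ->
  coherent n u ((12 * pi) ^+ n) M (\prod_i (m i)%:R) (\prod_i w i).
Proof.
move=> w0 hyp; pose N := \max_i m i.
have mN i : (m i <= N)%N by exact: leq_bigmax.
(* All the index ranges are embedded in the largest one; P selects the box. *)
pose y (k : {ffun 'I_n -> 'I_N}) : 'rV[R]_n := \row_i (o i + (k i)%:R).
pose P : pred {ffun 'I_n -> 'I_N} := [pred k | k \in family (fun i => [pred j : 'I_N | (j < m i)%N])].
have yP k : P k -> forall i, o i <= y k ord0 i <= o i + (m i)%:R - 1.
  move=> /familyP Pk i; rewrite mxE lerDl ler0n/= -addrA lerD2l lerBrDr natr1 ler_nat.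
  exact: Pk.
have prodP (f : forall i, 'I_N -> R) : \sum_(k | P k) \prod_i f i (k i) =
    \prod_i \sum_(j < N | (j < m i)%N) f i j.
  by rewrite (bigA_distr_big_dep (fun i (j : 'I_N) => (j < m i)%N)).
pose E : set 'rV[R]_n := [set x | forall i, l i <= x ord0 i <= l i + w i].
have EE : E = [set x : 'rV[R]_n | forall i, `[l i, l i + w i]%classic (x ord0 i)].
  by apply/seteqP; split => x /= h i; have := h i; rewrite in_itv.
exists {ffun 'I_n -> 'I_N}, P, y, (b \o y), S0, E, a; split.
- split.
    rewrite (_ : E = \bigcap_(i in [set: 'I_n])
        (fun x : 'rV[R]_n => x ord0 i) @^-1` `[l i, l i + w i]%classic).
      apply: fin_bigcap_measurable => // i _.
      by rewrite -[X in measurable X]setTI; exact: measurable_coord_rV.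
    by rewrite EE; apply/seteqP; split => x /= h i; [move=> _|]; exact: h.
  rewrite EE (@lebesgue_rV_box R n (fun i => `[l i, l i + w i]%classic))//.
  rewrite -prodEFin; apply: eq_bigr => i _.
  rewrite lebesgue_measure_itv/= lte_fin ltrDl.
  have [h|h] := ltP 0 (w i); first by rewrite -EFinB addrAC subrr add0r.
  by congr EFin; apply/eqP; rewrite eq_le h w0.
- transitivity (\sum_(k | P k) \prod_(i < n) (1 : R)).
    by apply: eq_bigr => k _; rewrite big1.
  rewrite (prodP (fun _ _ => 1)); apply: eq_bigr => i _.
  by rewrite -(big_ord_widen N (fun=> 1) (mN i)) sumr_const card_ord.
- move=> z.
  rewrite (eq_bigr (fun k : {ffun 'I_n -> 'I_N} => \prod_i expR (- (z ord0 i - o i - (k i)%:R) ^+ 2 / 4))); last first.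
    by move=> k _; rewrite gauss_prod; apply: eq_bigr => i _; rewrite !mxE opprD addrA.
  rewrite (prodP (fun i j => expR (- (z ord0 i - o i - j%:R) ^+ 2 / 4))).
  rewrite -[n in _ ^+ n]card_ord -prodr_const; apply: ler_prod => i _.
  rewrite sumr_ge0 => [|j _]; last exact: expR_ge0.
  rewrite -(big_ord_widen N (fun j => expR (- (z ord0 i - o i - j%:R) ^+ 2 / 4)) (mN i)).
  exact: lattice_gauss_sum1.
- move=> k Pk; have [] := hyp (\row_i l i) (y k) _ (yP k Pk) => //.
  by move=> i; rewrite mxE lexx lerDl w0.
- by move=> k x Pk Ex; have [_] := hyp x (y k) Ex (yP k Pk).
Qed.

End lattice.

(** * The three geometries *)
Section configurations.
Context (R : realType).

Lemma euclid_le_box n (w : 'rV[R]_n) (h : R) : (forall i, `|w ord0 i| <= h) ->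
  euclid w <= n%:R * h.
Proof.
move=> wh; apply: (le_trans (euclid_le_sum w)).
apply: (@le_trans _ _ (\sum_(i < n) h)); first exact: ler_sum.
by rewrite sumr_const card_ord mulr_natl.
Qed.

(** A single centre at the origin radiates to the cube with sides
[18 M^2, 36 M^2]. *)
Lemma coherent_point_source n (m : nat) : (0 < n)%N -> (0 < m)%N ->
  coherent n (36 * n%:R) ((12 * pi) ^+ n) (m%:R : R) (1 * m%:R ^+ 0)
    (18 ^+ n * m%:R ^+ (2 * n)).
Proof.
move=> n0 m0; have M1 : 1 <= m%:R :> R by rewrite (ler_nat _ 1%N).
have n1 : 1 <= n%:R :> R by rewrite (ler_nat _ 1%N).
set M : R := m%:R in M1 *.
have MM : 1 <= M ^+ 2 by rewrite exprn_ege1.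
have -> : 18 ^+ n * M ^+ (2 * n) = \prod_(i < n) (18 * M ^+ 2).
  by rewrite prodr_const card_ord exprMn exprM.
have -> : 1 * M ^+ 0 = \prod_(i < n) (1%N)%:R by rewrite big1// mulr1.
apply: (@coherent_boxes _ _ _ _ 0 (fun=> 18 * M ^+ 2) _ (fun=> 0) (fun=> 1%N)
  (@euclid R n) (fun=> 0)).
  by move=> i; lra.
move=> x y hx hy.
have -> : y = 0.
  apply/rowP => i; rewrite mxE; apply/eqP; rewrite eq_le; have := hy i; lra.
rewrite !subr0 subrr normr0; split => //.
rewrite (le_trans _ (coord_le_euclid x (Ordinal n0))); last by have := hx (Ordinal n0); lra.
apply: (le_trans (@euclid_le_box _ _ (36 * M ^+ 2) _)).
  by move=> i; have := hx i; rewrite ler_norml; lra.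
by rewrite mulrCA mulrA.
Qed.

(** The centres in the cube with sides [19 M^2, 37 M^2] focus on the cube with
sides [0, 1/(2n)], whose points have norm at most 1/2; the triangle inequality
gives the splitting. *)
Lemma coherent_focus n (m : nat) : (0 < n)%N -> (0 < m)%N ->
  coherent n (37 * n%:R + 1) ((12 * pi) ^+ n) (m%:R : R) (18 ^+ n * m%:R ^+ (2 * n))
    ((2 * n%:R)^-1 ^+ n * m%:R ^+ 0).
Proof.
move=> n0 m0; have M1 : 1 <= m%:R :> R by rewrite (ler_nat _ 1%N).
have n1 : 1 <= n%:R :> R by rewrite (ler_nat _ 1%N).
set M : R := m%:R in M1 *.
have MM : 1 <= M ^+ 2 by rewrite exprn_ege1.
have -> : 18 ^+ n * M ^+ (2 * n) = \prod_(i < n) ((18 * m ^ 2)%N)%:R.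
  by rewrite prodr_const card_ord natrM natrX exprMn exprM.
have e1 : (2 * n%:R)^-1 <= 1 :> R by rewrite invf_le1 ?mulr_gt0//; lra.
have e0 : 0 <= (2 * n%:R)^-1 :> R by rewrite invr_ge0 mulr_ge0.
have -> : (2 * n%:R)^-1 ^+ n * M ^+ 0 = \prod_(i < n) (2 * n%:R)^-1 :> R.
  by rewrite mulr1 prodr_const card_ord.
apply: (@coherent_boxes _ _ _ _ (n%:R * (37 * M ^+ 2)) (fun=> 0) _ (fun=> 19 * M ^+ 2) _
  (fun=> 0) (@euclid R n)) => //.
move=> x y hx hy.
have {}hy i : 19 * M ^+ 2 <= y ord0 i <= 37 * M ^+ 2.
  have := hy i; rewrite natrM natrX -/M; lra.
have ex : euclid x <= 1 / 2.
  apply: (le_trans (@euclid_le_box _ _ (2 * n%:R)^-1 _)).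
    by move=> i; have := hx i; rewrite ler_norml; lra.
  by rewrite invfM mulrCA divff ?mulr1 ?div1r// gt_eqF//; lra.
have ey : euclid y <= n%:R * (37 * M ^+ 2).
  by apply: euclid_le_box => i; have := hy i; rewrite ler_norml; lra.
have exy : euclid (x - y) <= euclid x + euclid y.
  by rewrite (le_trans (euclid_triangle _ _))// euclidN.
have eyx : euclid y <= euclid x + euclid (x - y).
  by rewrite -[leLHS]euclidN (_ : - y = - x + (x - y)) ?(le_trans (euclid_triangle _ _)) ?euclidN// addKr.
split => //; first by rewrite subr0 ler_norml; lra.
have := coord_le_euclid (y - x) (Ordinal n0); rewrite -euclidN opprB !mxE.
have := hx (Ordinal n0); have := hy (Ordinal n0); move: n1; nra.
Qed.

(** With D = x_0 - y_0 >= K M^2, the other coordinates of x - y are at most M, so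
that d^2 <= D^2 + n M^2 and d - D <= n M^2/(2 K M^2) <= 1/2. *)
Lemma coherent_beam n (m : nat) : (0 < m)%N ->
  let K := n%:R + 19 in
  coherent n.+1 (3 * K + 1) ((12 * pi) ^+ n.+1) (m%:R : R) (K * m%:R ^+ n.+2)
    (K * m%:R ^+ n.+2).
Proof.
move=> m0 K; have M1 : 1 <= m%:R :> R by rewrite (ler_nat _ 1%N).
have nn : 0 <= n%:R :> R by [].
set M : R := m%:R in M1 *.
have MM : 1 <= M ^+ 2 by rewrite exprn_ege1.
have K18 : 19 <= K by rewrite /K; lra.
have KM : K <= K * M ^+ 2 by rewrite ler_peMr//; lra.
pose wide (i : 'I_n.+1) : nat := if i == ord0 then ((n + 19) * m ^ 2)%N else m.
have wide0 : (wide ord0)%:R = K * M ^+ 2 by rewrite /wide eqxx natrM natrX natrD.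
have wideS i : wide (lift ord0 i) = m by rewrite /wide.
have -> : K * M ^+ n.+2 = \prod_i (wide i)%:R.
  rewrite big_ord_recl wide0 -mulrA -[n.+2]/(2 + n)%N exprD; congr (_ * (_ * _)).
  by rewrite (eq_bigr (fun=> M)) ?prodr_const ?card_ord// => i _; rewrite wideS.
apply: (@coherent_boxes _ _ _ _ 0
  (fun i => if i == ord0 then 2 * (K * M ^+ 2) else 0) _ (fun=> 0) _
  (fun x => x ord0 ord0) (fun y => - y ord0 ord0)) => //.
move=> x y hx hy.
have := hx ord0; have := hy ord0; rewrite eqxx wide0 => hy0 hx0.
set D := x ord0 ord0 - y ord0 ord0.
have [D1 D2] : K * M ^+ 2 <= D /\ D <= 3 * (K * M ^+ 2) by rewrite /D; split; lra.
have D0 : 0 < D by lra.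
have DE : D <= euclid (x - y) by have := coord_le_euclid (x - y) ord0; rewrite !mxE.
have ED : euclid (x - y) ^+ 2 <= D ^+ 2 + n%:R * M ^+ 2.
  rewrite euclid_sqr /dot_rV big_ord_recl !mxE -/D -expr2 lerD2l.
  rewrite (_ : n%:R * M ^+ 2 = \sum_(i < n) M ^+ 2); last first.
    by rewrite sumr_const card_ord mulr_natl.
  apply: ler_sum => i _; rewrite !mxE -expr2 -real_normK ?num_real//.
  apply: lerXn2r; rewrite ?nnegrE//.
  have := hx (lift ord0 i); have := hy (lift ord0 i); rewrite wideS /= -/M ler_norml.
  lra.
have Dd : euclid (x - y) - D <= 1 / 2.
  (* The product (d - D)(d + D) is at most n M^2, and d + D >= 2 K M^2. *)
  have : (euclid (x - y) - D) * (2 * (K * M ^+ 2)) <= n%:R * M ^+ 2.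
    have : 0 <= euclid (x - y) - D by rewrite subr_ge0.
    move: ED D1; set d := euclid _; set Z := K * M ^+ 2; nra.
  have : n%:R * M ^+ 2 <= K * M ^+ 2 by rewrite ler_wpM2r ?sqr_ge0// /K; lra.
  move: KM K18; set Z := K * M ^+ 2; set W := n%:R * M ^+ 2; nra.
have K18M : 18 * M ^+ 2 <= K * M ^+ 2 by rewrite ler_wpM2r ?sqr_ge0//; lra.
split; first by lra.
  rewrite ler_norml; move: Dd DE; rewrite /D; lra.
by apply/andP; split; lra.
Qed.

End configurations.

Theorem mainTheorem3 (R : realType) (n : nat) (hn : (1 <= n)%N)
    (q r q1 r1 : \bar R)
    (hq : (1 <= q)%E) (hr : (1 <= r)%E) (hq1 : (1 <= q1)%E) (hr1 : (1 <= r1)%E)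
    (hbound : exists C : R, forall F : 'rV[R]_n * R -> R[i], schwartz F ->
      (mixed_norm r q (duhamel F) <=
       C%:E * mixed_norm (hoelder_conjugate r1) (hoelder_conjugate q1) F)%E) :
  let iq := inv_exponent q in
  let ir := inv_exponent r in
  let iq1' := inv_exponent (hoelder_conjugate q1) in
  let ir1' := inv_exponent (hoelder_conjugate r1) in
  [/\ iq1' - iq + (n%:R + 1) * (ir1' - ir) >= 2,
      iq1' - iq >= 2 * n%:R * ir - n%:R + 1 &
      iq1' - iq >= n%:R + 1 - 2 * n%:R * ir1'].
Proof.
have [K hK] := hbound.
have q1'_ge1 := hoelder_conj_ge1 hq1; have r1'_ge1 := hoelder_conj_ge1 hr1.
have D0 : 0 < (12 * pi) ^+ n :> R by rewrite exprn_gt0// mulr_gt0// pi_gt0.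
have n_gt0 : 0 < n%:R :> R by rewrite ltr0n.
move=> iq ir iq1' ir1'; split.
- case: n hn hK D0 n_gt0 {hbound} => // n _ hK D0 _.
  have K0 : 0 < n%:R + 19 :> R by rewrite ltr_wpDl.
  have := scaling_condition hq hr q1'_ge1 r1'_ge1 hK D0 K0 K0 (@coherent_beam R n).
  rewrite -/iq -/ir -/iq1' -/ir1' -![n.+1%:R]natr1 -![n.+2%:R]natr1 -![n.+1%:R]natr1; lra.
- have := scaling_condition hq hr q1'_ge1 r1'_ge1 hK D0 ltr01 (exprn_gt0 n _)
    (fun m => @coherent_point_source R n m hn).
  by move=> /(_ ltac:(by [])); rewrite -/iq -/ir -/iq1' -/ir1' natrM; lra.
- have V0 : 0 < (2 * n%:R)^-1 ^+ n :> R by rewrite exprn_gt0// invr_gt0 mulr_gt0.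
  have := scaling_condition hq hr q1'_ge1 r1'_ge1 hK D0 (exprn_gt0 n _) V0
    (fun m => @coherent_focus R n m hn).
  by move=> /(_ ltac:(by [])); rewrite -/iq -/ir -/iq1' -/ir1' natrM; lra.
Qed.
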